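(* Let $\sigma,y,\beta$ be strictly positive real numbers such that $$\varepsilon:=\frac{\beta}{\sigma^2y}\in(0,1).$$ Let $X_1,\dots,X_n$ be independent real-valued random variables with sum $S:=X_1+\dots+X_n$, and suppose that $$\sum_i \mathsf{E}X_i^2\le\sigma^2,\qquad \sum_i\mathsf{E}(X_i)_+^3\le\beta,$$ and that for all $i$ one has $\mathsf{E}X_i\le0$ and $X_i\le y$ almost surely. Then $$\mathsf{E}f(S)\le\mathsf{E}f\big(\Gamma_{(1-\varepsilon)\sigma^2}+y\tilde\Pi_{\varepsilon\sigma^2/y^2}\big)$$ for all $f\in\mathcal{F}_+^3$.
   Context: Notation: $x_+:=\max(0,x)$ and $x_+^\alpha:=(x_+)^\alpha$. For $a>0$ and $\theta>0$, $\Gamma_{a^2}$ and $\Pi_\theta$ denote independent random variables with $\Gamma_{a^2}\sim N(0,a^2)$ (normal) and $\Pi_\theta\sim\mathrm{Pois}(\theta)$ (Poisson), and $\tilde\Pi_\theta:=\Pi_\theta-\theta$. $\mathcal{F}_+^3$ is the class of all twice continuously differentiable functions $f\colon\mathbb{R}\to\mathbb{R}$ such that $f$ and $f''$ are nondecreasing and convex; equivalently, such that $f,f',f'',f'''$ are all nondecreasing, where $f'''$ denotes the right derivative of the convex function $f''$. For convex $f$ and a random variable $X$ with finite mean, $\mathsf{E}f(X)$ exists in $(-\infty,\infty]$. *)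

(* Defs.v *)
From HB Require Import structures.
From mathcomp Require Import all_boot all_order all_algebra.
From mathcomp Require Import all_classical all_reals all_analysis.

Set Implicit Arguments.
Unset Strict Implicit.
Unset Printing Implicit Defensive.

Import Order.TTheory GRing.Theory Num.Theory.
Import numFieldNormedType.Exports.

Local Open Scope classical_set_scope.
Local Open Scope ring_scope.

Definition mutually_independent d d' (T : measurableType d)
    (T' : measurableType d') (R : realType) (P : probability T R)
    (I : finType) (X : I -> {RV P >-> T'}) : Prop :=
  forall (J : {set I}) (A : I -> set T'),
    (forall i, i \in J -> measurable (A i)) ->
    P (\bigcap_(i in [set` J]) (X i @^-1` A i)) =
    (\prod_(i in J) P (X i @^-1` A i))%E.

Arguments mutually_independent {d d' T T' R} P {I} X.

(* Two random variables whose target spaces may differ. *)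
Definition independent_pair d d1 d2 (T : measurableType d)
    (T1 : measurableType d1) (T2 : measurableType d2) (R : realType)
    (P : probability T R) (X : {RV P >-> T1}) (Y : {RV P >-> T2}) : Prop :=
  forall (A : set T1) (B : set T2), measurable A -> measurable B ->
    P ((X @^-1` A) `&` (Y @^-1` B)) = (P (X @^-1` A) * P (Y @^-1` B))%E.

Arguments independent_pair {d d1 d2 T T1 T2 R} P X Y.

(* normal_prob takes the standard deviation, v is the variance. When v = 0 the
   library's normal_prob is not the Dirac mass, hence only v > 0 is meaningful
   here. *)
Definition centered_normal d (T : measurableType d) (R : realType)
    (P : probability T R) (v : R) (G : {RV P >-> R}) : Prop :=
  forall A : set R, measurable A ->
    distribution P G A = normal_prob 0 (Num.sqrt v) A.

Arguments centered_normal {d T R} P v G.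

(* The nat argument of poisson_prob does not occur in its body. *)
Definition poisson d (T : measurableType d) (R : realType)
    (P : probability T R) (theta : R) (N : {RV P >-> nat}) : Prop :=
  forall A : set nat, measurable A ->
    distribution P N A = poisson_prob theta 0%N A.

Arguments poisson {d T R} P theta N.

Definition C2 (R : realType) (f : R -> R) : Prop :=
  [/\ forall x, derivable f x 1,
      forall x, derivable (f^`())%classic x 1
    & continuous (f^`(2))%classic].

Definition Fplus3 (R : realType) (f : R -> R) : Prop :=
  [/\ C2 f,
      {homo f : x y / x <= y},
      convex_function [set: R^o] f,
      {homo (f^`(2))%classic : x y / x <= y}
    & convex_function [set: R^o] (f^`(2))%classic].

(* Main.v *)
Require Import Defs.
From HB Require Import structures.
From mathcomp Require Import all_boot all_order all_algebra.
From mathcomp Require Import all_classical all_reals all_analysis.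
From mathcomp Require Import measurable_realfun ring lra.

Import Order.TTheory GRing.Theory Num.Theory.
Import numFieldNormedType.Exports.

Local Open Scope classical_set_scope.
Local Open Scope ring_scope.

Set Implicit Arguments.
Unset Strict Implicit.
Unset Printing Implicit Defensive.

(** The proof compares the law of each summand with a small piece of the
    Gaussian-plus-Poisson law and then exchanges the summands one at a time.

    Let X satisfy E X <= 0, X <= y, E X^2 = s and E X_+^3 <= b <= y s, and put
    v = s - b/y and t = b/y^3. Write Gam_v for a centred normal variable of
    variance v, Pi_t for an independent Poisson variable, and
    J(u) = f(u+y) - f(u) - y f'(u).

    - Since f'' is nondecreasing and convex, the second-order Taylor remainder
      of f at u is nonpositive at x <= 0 and is at most (x/y)^3 times its value
      at y when 0 <= x <= y ([taylor3_le]). Integrating this bound gives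
      E f(u+X) <= f(u) + v f''(u)/2 + t J(u) ([smear_le_taylor]). The last two
      terms are the generator, applied to f, of the process with independent
      increments whose increments are Gam_v + y (Pi_t - t).

    - The same expression bounds E f(u + Gam_v + y (Pi_t - t)) from below
      ([le_gauss_pois_smear]). For the Poisson part, f lies above the cubic
      tangent to it at u and at u + y, because f'' is convex, and the
      expectation of a cubic only involves the first three central moments 0,
      t, t of Pi_t. For the Gaussian part, pairing g with -g reduces the claim
      to midpoint inequalities and to the second moment.

    Together these give E f(u+X) <= E f(u + Gam_v + y (Pi_t - t)) for every u.
    As u is arbitrary, the inequality survives convolution with any law, so
    the summands can be exchanged successively; normal and Poisson laws
    convolve by adding their parameters ([lindeberg]). The variance and the
    third moment left unused by the hypotheses are distributed over the
    summands so that the parameters add up to the prescribed ones.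

    All integrals are taken of the nonnegative function
    h(x) = f(x) - f(0) - f'(0) x, so that Tonelli's theorem applies even where
    expectations are infinite. Then h' >= -f'(0), and passing from f to h
    costs the nonnegative quantity f'(0) (- E X_i) in each exchange. The sum of
    these costs is exactly what the affine part of f gives back in the end. *)

(** * Derivatives and convexity inequalities *)

Section derivatives.
Context {R : realType}.
Implicit Types (f g D : R -> R).

(** [is_derive] is a type class, and its resolution would commit to a shape of
    the derivative too early; behind a plain predicate the derivative can stay
    an existential variable while [der] descends through the expression. *)
Definition has_der f (x a : R) : Prop := is_derive x 1 f a.

Lemma der_eq f (x a b : R) : has_der f x a -> a = b -> has_der f x b.
Proof. by move=> ? <-. Qed.

Lemma der_cst (c x : R) : has_der (fun _ : R => c) x 0.
Proof. exact: is_derive_cst. Qed.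

Lemma der_id (x : R) : has_der (fun t : R => t) x 1.
Proof. exact: is_derive_id. Qed.

Lemma der_add f g (x a b : R) : has_der f x a -> has_der g x b ->
  has_der (fun t => f t + g t) x (a + b).
Proof. by move=> ? ?; exact: is_deriveD. Qed.

Lemma der_opp f (x a : R) : has_der f x a -> has_der (fun t => - f t) x (- a).
Proof. by move=> ?; exact: is_deriveN. Qed.

Lemma der_mul f g (x a b : R) : has_der f x a -> has_der g x b ->
  has_der (fun t => f t * g t) x (f x * b + g x * a).
Proof. by move=> ? ?; exact: is_deriveM. Qed.

Lemma der_exp f n (x a : R) : has_der f x a ->
  has_der (fun t => f t ^+ n.+1) x (n.+1%:R * f x ^+ n * a).
Proof.
by move=> fa; have := @is_deriveX _ _ f n.+1 x 1 a fa; rewrite exprfctE.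
Qed.

Lemma der_comp f g (x a b : R) : has_der f (g x) a -> has_der g x b ->
  has_der (fun t => f (g t)) x (a * b).
Proof. by move=> ? ?; exact: (@is_derive1_comp _ f g). Qed.

Lemma ge0_der_ge D (D1 : R -> R) : (forall t : R, has_der D t (D1 t)) ->
  (forall t : R, 0 <= t -> 0 <= D1 t) -> forall t : R, 0 <= t -> D 0 <= D t.
Proof.
move=> dD D1_ge0 t t0.
have [s] := @MVT_segment _ D D1 0 t t0 (fun x _ => dD x)
  (derivable_within_continuous (fun x _ => @ex_derive _ _ _ _ _ _ _ (dD x))).
rewrite in_itv/= subr0 => /andP[s0 _] E.
by rewrite -subr_ge0 E mulr_ge0// D1_ge0.
Qed.

(** The convexity inequalities below come from this lemma or from the previous
    one, applied to the difference of the two sides as a function of one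
    parameter at whose value 0 the difference vanishes. *)
Lemma ge0_der2_ge0 D (D1 D2 : R -> R) :
  (forall t : R, has_der D t (D1 t)) -> (forall t : R, has_der D1 t (D2 t)) ->
  D 0 = 0 -> D1 0 = 0 -> (forall t : R, 0 <= t -> 0 <= D2 t) ->
  forall t : R, 0 <= t -> 0 <= D t.
Proof.
move=> dD dD1 D0 D10 D2_ge0 t t0; rewrite -[leLHS]D0.
apply: ge0_der_ge dD _ _ t0 => s s0; rewrite -[leLHS]D10.
exact: ge0_der_ge dD1 _ _ s0.
Qed.

End derivatives.

Ltac der := lazymatch goal with
  | |- has_der (fun _ => ?c) _ _ => eapply der_cst
  | |- has_der (fun t => t) _ _ => eapply der_id
  | |- has_der (fun t => @?f t + @?g t) _ _ => eapply (@der_add _ f g); der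
  | |- has_der (fun t => - @?f t) _ _ => eapply (@der_opp _ f); der
  | |- has_der (fun t => @?f t * @?g t) _ _ => eapply (@der_mul _ f g); der
  | |- has_der (fun t => @?f t ^+ ?n) _ _ => eapply (@der_exp _ f); der
  | |- has_der (fun t => ?f (@?g t)) _ _ => eapply (@der_comp _ f g); [now auto | der]
  end.

Ltac der_ring := apply: der_eq; [by der | rewrite /=; by field].

Section C2_third_order_convex.
Context {R : realType} (f f1 f2 : R -> R).
Context (df : forall x : R, has_der f x (f1 x))
  (df1 : forall x : R, has_der f1 x (f2 x))
  (f2_ge0 : forall x, 0 <= f2 x) (f2_homo : {homo f2 : x y / x <= y})
  (f2_conv : forall a b t : R, 0 <= t -> t <= 1 ->
     f2 (t * a + (1 - t) * b) <= t * f2 a + (1 - t) * f2 b).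

Lemma taylor2_neg u t : 0 <= t ->
  f (u - t) <= f u - f1 u * t + f2 u * t ^+ 2 / 2.
Proof.
move=> t0; rewrite -subr_ge0.
pose D t := f u - f1 u * t + f2 u * t ^+ 2 / 2 - f (u - t).
apply: (@ge0_der2_ge0 _ D (fun t => - f1 u + f2 u * t + f1 (u - t))
  (fun t => f2 u - f2 (u - t))).
- by move=> x; rewrite /D; der_ring.
- by move=> x; der_ring.
- by rewrite /D subr0; field.
- by rewrite subr0; ring.
- by move=> r r0; rewrite subr_ge0 f2_homo// gerBl.
- exact: t0.
Qed.

Definition rem2 u t := f (u + t) - f u - f1 u * t - f2 u * t ^+ 2 / 2.

Lemma rem2_ge0 u t : 0 <= t -> 0 <= rem2 u t.
Proof.
apply: (@ge0_der2_ge0 _ (rem2 u) (fun t => f1 (u + t) - f1 u - f2 u * t)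
  (fun t => f2 (u + t) - f2 u)).
- by move=> x; rewrite /rem2; der_ring.
- by move=> x; der_ring.
- by rewrite /rem2 addr0; field.
- by rewrite addr0; ring.
- by move=> r r0; rewrite subr_ge0 f2_homo// lerDl.
Qed.

(** With T the remainder, T'' (s) = f2 (u + s) - f2 u is convex and vanishes at
    0, so T'' (l s) <= l T'' (s); integrating twice gives the factor l^3. *)
Lemma rem2_scale u l t : 0 <= l -> l <= 1 -> 0 <= t ->
  rem2 u (l * t) <= l ^+ 3 * rem2 u t.
Proof.
move=> l0 l1 t0; rewrite -subr_ge0.
pose D t := l ^+ 3 * rem2 u t - rem2 u (l * t).
apply: (@ge0_der2_ge0 _ D
  (fun t => l ^+ 3 * (f1 (u + t) - f1 u - f2 u * t)
            - l * (f1 (u + l * t) - f1 u - f2 u * (l * t)))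
  (fun t => l ^+ 2 * (l * f2 (u + t) + (1 - l) * f2 u - f2 (u + l * t)))).
- by move=> x; rewrite /D /rem2; der_ring.
- by move=> x; der_ring.
- by rewrite /D /rem2 !mulr0 !addr0; field.
- by rewrite !mulr0 !addr0; ring.
- move=> r r0; rewrite mulr_ge0 ?sqr_ge0// subr_ge0.
  have -> : u + l * r = l * (u + r) + (1 - l) * u by ring.
  exact: f2_conv.
- exact: t0.
Qed.

Lemma taylor3_le u x y : 0 < y -> x <= y ->
  f (u + x) <= f u + f1 u * x + f2 u * x ^+ 2 / 2
               + Num.max 0 x ^+ 3 / y ^+ 3 * rem2 u y.
Proof.
move=> y0 xy; have [x0|x0] := leP 0 x.
  have l0 : 0 <= x / y by rewrite divr_ge0// ltW.
  have l1 : x / y <= 1 by rewrite ler_pdivrMr// mul1r.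
  have := rem2_scale u l0 l1 (ltW y0).
  by rewrite divfK ?gt_eqF// expr_div_n /rem2; lra.
have := @taylor2_neg u (- x); rewrite oppr_ge0 opprK sqrrN => /(_ (ltW x0)).
by rewrite expr0n /= !mul0r; lra.
Qed.

Lemma ge_tangent u x : f u + f1 u * x <= f (u + x).
Proof.
have pos t : 0 <= t -> 0 <= f (u + t) - f u - f1 u * t.
  apply: (@ge0_der2_ge0 _ (fun t => f (u + t) - f u - f1 u * t)
    (fun t => f1 (u + t) - f1 u) (fun t => f2 (u + t))).
  - by move=> r; der_ring.
  - by move=> r; der_ring.
  - by rewrite addr0; ring.
  - by rewrite addr0; ring.
  - by move=> r _; exact: f2_ge0.
have neg t : 0 <= t -> 0 <= f (u - t) - f u + f1 u * t.
  apply: (@ge0_der2_ge0 _ (fun t => f (u - t) - f u + f1 u * t)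
    (fun t => - f1 (u - t) + f1 u) (fun t => f2 (u - t))).
  - by move=> r; der_ring.
  - by move=> r; der_ring.
  - by rewrite subr0; ring.
  - by rewrite subr0; ring.
  - by move=> r _; exact: f2_ge0.
have [x0|x0] := leP 0 x; first by have := pos _ x0; lra.
have := neg (- x); rewrite oppr_ge0 opprK => /(_ (ltW x0)); lra.
Qed.

(** Convexity puts the chord above the graph between the nodes and below it
    outside; the sign of m (1 - m) tells the cases apart. In each of them the
    middle one among the three points is a barycentre of the two others. *)
Lemma conv_extrapolation v m s :
  0 <= m * (1 - m) * (m * f2 (v - s) + (1 - m) * f2 v - f2 (v - m * s)).
Proof.
have [m0|m0] := ltP m 0.
  rewrite -mulrNN mulr_ge0//; first by nra.
  have n0 : 0 < 1 - m by lra.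
  have := @f2_conv (v - m * s) (v - s) ((1 - m)^-1).
  rewrite invr_ge0 invf_le1// ltW// => /(_ isT); rewrite lerDl oppr_ge0 ltW//.
  move=> /(_ isT); have -> : (1 - m)^-1 * (v - m * s) +
      (1 - (1 - m)^-1) * (v - s) = v by field; rewrite gt_eqF.
  have -> : 1 - (1 - m)^-1 = - m / (1 - m) by field; rewrite gt_eqF.
  rewrite -(ler_pM2l n0).
  have -> : (1 - m) * ((1 - m)^-1 * f2 (v - m * s) + - m / (1 - m) * f2 (v - s))
    = f2 (v - m * s) - m * f2 (v - s) by field; rewrite gt_eqF.
  by lra.
have [m1|m1] := leP m 1.
  rewrite mulr_ge0//; first by nra.
  rewrite subr_ge0.
  have -> : v - m * s = m * (v - s) + (1 - m) * v by ring.
  exact: f2_conv.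
rewrite -mulrNN mulr_ge0//; first by nra.
have n0 : 0 < m by lra.
have := @f2_conv (v - m * s) v (m^-1).
rewrite invr_ge0 invf_le1// (ltW m1) m0 => /(_ isT isT).
have -> : m^-1 * (v - m * s) + (1 - m^-1) * v = v - s by field; rewrite gt_eqF.
rewrite -(ler_pM2l n0).
have -> : m * (m^-1 * f2 (v - m * s) + (1 - m^-1) * f2 v)
    = f2 (v - m * s) + (m - 1) * f2 v by field; rewrite gt_eqF.
by lra.
Qed.

(** This is the sign of the error of quadratic interpolation of f1 at the nodes
    v - s (simple) and v (double), evaluated at v - m s; it is the derivative
    of the error of the cubic interpolation below. *)
Lemma ge_hermite2 v m s : 0 <= s ->
  0 <= (1 - m) * (f1 (v - m * s) - m ^+ 2 * f1 (v - s) - (1 - m ^+ 2) * f1 v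
                  - (m ^+ 2 - m) * s * f2 v).
Proof.
move=> s0; pose W s := (1 - m) * (f1 (v - m * s) - m ^+ 2 * f1 (v - s)
  - (1 - m ^+ 2) * f1 v - (m ^+ 2 - m) * s * f2 v).
have W0 : W 0 = 0 by rewrite /W mulr0 !subr0; ring.
rewrite -W0; apply: (@ge0_der_ge _ W (fun s => m * (1 - m) *
  (m * f2 (v - s) + (1 - m) * f2 v - f2 (v - m * s)))).
- by move=> x; rewrite /W; der_ring.
- by move=> t t0; exact: conv_extrapolation.
- exact: s0.
Qed.

(** The left-hand side is the cubic which agrees with f to first order at u and
    at u + y, evaluated at u + x y. The error of this interpolation has the
    sign of a fourth derivative times (x (1 - x))^2, hence is nonnegative when
    f2 is convex. *)
Lemma ge_hermite3 u x y : 0 <= y ->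
  (1 - 3 * x ^+ 2 + 2 * x ^+ 3) * f u
  + (x - 2 * x ^+ 2 + x ^+ 3) * (y * f1 u)
  + (3 * x ^+ 2 - 2 * x ^+ 3) * f (u + y)
  + (x ^+ 3 - x ^+ 2) * (y * f1 (u + y)) <= f (u + x * y).
Proof.
move=> y0; rewrite -subr_ge0.
pose D y := f (u + x * y) - ((1 - 3 * x ^+ 2 + 2 * x ^+ 3) * f u
  + (x - 2 * x ^+ 2 + x ^+ 3) * (y * f1 u)
  + (3 * x ^+ 2 - 2 * x ^+ 3) * f (u + y)
  + (x ^+ 3 - x ^+ 2) * (y * f1 (u + y))).
(* the two nodes merge at y = 0, where both sides equal f u *)
have D0 : D 0 = 0 by rewrite /D mulr0 !addr0; ring.
rewrite -[leLHS]D0; apply: (@ge0_der_ge _ D (fun y => x * (f1 (u + x * y)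
  - (1 - x) ^+ 2 * f1 u - (2 * x - x ^+ 2) * f1 (u + y)
  - (x ^+ 2 - x) * y * f2 (u + y)))).
- by move=> t; rewrite /D; der_ring.
- move=> t t0; have := @ge_hermite2 (u + t) (1 - x) t t0.
  rewrite addrK; have -> : u + t - (1 - x) * t = u + x * t by ring.
  by congr (_ <= _); ring.
- exact: y0.
Qed.

Lemma ge_midpoint w g : 2 * f w + f2 w * g ^+ 2 <= f (w + g) + f (w - g).
Proof.
have pos t : 0 <= t -> 0 <= f (w + t) + f (w - t) - (2 * f w + f2 w * t ^+ 2).
  apply: (@ge0_der2_ge0 _
    (fun t => f (w + t) + f (w - t) - (2 * f w + f2 w * t ^+ 2))
    (fun t => f1 (w + t) - f1 (w - t) - f2 w * (2 * t))
    (fun t => f2 (w + t) + f2 (w - t) - f2 w * 2)).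
  - by move=> r; der_ring.
  - by move=> r; der_ring.
  - by rewrite addr0 subr0; ring.
  - by rewrite addr0 subr0; ring.
  - move=> r _; have := @f2_conv (w + r) (w - r) 2^-1.
    have -> : 2^-1 * (w + r) + (1 - 2^-1) * (w - r) = w by field.
    have h1 : 0 <= 2^-1 :> R by lra.
    have h2 : 2^-1 <= 1 :> R by lra.
    by move=> /(_ h1 h2); lra.
have [g0|g0] := leP 0 g; first by have := pos _ g0; lra.
by have := pos (- g); rewrite oppr_ge0 opprK sqrrN => /(_ (ltW g0)); lra.
Qed.

(** Up to the rate, the generator of a compensated Poisson process with jumps
    of size y, applied to f. *)
Definition jump y u := f (u + y) - f u - y * f1 u.

Lemma jump_ge0 y u : 0 <= jump y u.
Proof. by have := ge_tangent u y; rewrite /jump; lra. Qed.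

Lemma ge_midpoint_jump y w g : 0 <= y ->
  2 * jump y w <= jump y (w + g) + jump y (w - g).
Proof.
move=> y0; rewrite -subr_ge0.
pose D y := jump y (w + g) + jump y (w - g) - 2 * jump y w.
apply: (@ge0_der2_ge0 _ D
    (fun t => f1 (w + g + t) - f1 (w + g) + (f1 (w - g + t) - f1 (w - g))
              - 2 * (f1 (w + t) - f1 w))
    (fun t => f2 (w + g + t) + f2 (w - g + t) - 2 * f2 (w + t))).
- by move=> r; rewrite /D /jump; der_ring.
- by move=> r; der_ring.
- by rewrite /D /jump !addr0; ring.
- by rewrite !addr0; ring.
- move=> r _; have := @f2_conv (w + g + r) (w - g + r) 2^-1.
  have -> : 2^-1 * (w + g + r) + (1 - 2^-1) * (w - g + r) = w + r by field.
  have h1 : 0 <= 2^-1 :> R by lra.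
  have h2 : 2^-1 <= 1 :> R by lra.
  by move=> /(_ h1 h2); lra.
- exact: y0.
Qed.

End C2_third_order_convex.

(** * The class of test functions *)

Section Fplus3_class.
Context {R : realType}.

Lemma convex_functionP (g : R -> R) : convex_function [set: R^o] g ->
  forall a b t : R, 0 <= t -> t <= 1 ->
    g (t * a + (1 - t) * b) <= t * g a + (1 - t) * g b.
Proof.
move=> gconv a b t t0 t1.
by have := gconv (Itv01 t0 t1) a b; rewrite !inE => /(_ Logic.I Logic.I).
Qed.

Lemma Fplus3_der (f : R -> R) : Fplus3 f ->
  (forall x, has_der f x ((f^`())%classic x)) /\
  (forall x, has_der (f^`())%classic x ((f^`(2))%classic x)).
Proof.
move=> [[df ddf _] _ _ _ _]; split=> x.
  by rewrite /has_der derive1E; exact/derivableP.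
by rewrite /has_der [X in is_derive _ _ _ X](derive1E (f^`())%classic x); exact/derivableP.
Qed.

(** If f2 u < 0, monotonicity makes f uniformly strictly concave on the left of
    u, which contradicts midpoint convexity at u - 2, u - 1, u. *)
Lemma ge0_second_der (f f1 f2 : R -> R) :
  (forall x, has_der f x (f1 x)) -> (forall x, has_der f1 x (f2 x)) ->
  {homo f2 : x y / x <= y} ->
  (forall a b t, 0 <= t -> t <= 1 ->
     f (t * a + (1 - t) * b) <= t * f a + (1 - t) * f b) ->
  forall u, 0 <= f2 u.
Proof.
move=> df df1 f2_homo f_conv u; rewrite leNgt; apply/negP => f2u.
suff : 0 <= 2 * f (u - 1) - f u - f (u - 2 * 1) + f2 u * 1 ^+ 2.
  have := f_conv (u - 2) u 2^-1.
  have -> : 2^-1 * (u - 2) + (1 - 2^-1) * u = u - 1 by field.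
  have h1 : 0 <= 2^-1 :> R by lra.
  have h2 : 2^-1 <= 1 :> R by lra.
  by rewrite mulr1 => /(_ h1 h2); lra.
apply: (@ge0_der2_ge0 _
    (fun t => 2 * f (u - t) - f u - f (u - 2 * t) + f2 u * t ^+ 2)
    (fun t => - 2 * f1 (u - t) + 2 * f1 (u - 2 * t) + 2 * f2 u * t)
    (fun t => 2 * f2 (u - t) - 4 * f2 (u - 2 * t) + 2 * f2 u)).
- by move=> t; der_ring.
- by move=> t; der_ring.
- by rewrite !mulr0 !subr0; ring.
- by rewrite !mulr0 !subr0; ring.
- move=> t t0.
  have h1 : f2 (u - 2 * t) <= f2 (u - t) by apply: f2_homo; lra.
  have h2 : f2 (u - 2 * t) <= f2 u by apply: f2_homo; lra.
  by lra.
- exact: ler01.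
Qed.

(** If f1 u < 0, the tangent at u makes f (u - 1) exceed f u. *)
Lemma ge0_first_der (f f1 f2 : R -> R) :
  (forall x, has_der f x (f1 x)) -> (forall x, has_der f1 x (f2 x)) ->
  (forall x, 0 <= f2 x) -> {homo f : x y / x <= y} ->
  forall u, 0 <= f1 u.
Proof.
move=> df df1 f2_ge0 f_homo u; rewrite leNgt; apply/negP => f1u.
have := ge_tangent df df1 f2_ge0 u (- 1).
have : f (u + - 1) <= f u by apply: f_homo; lra.
by lra.
Qed.

End Fplus3_class.

(** * Expectation of a shifted function *)

Section shifted_integral.
Local Open Scope ereal_scope.
Context {R : realType}.
Implicit Types (phi psi : R -> \bar R) (u : R).

(** The function u |-> E phi (u + g). Keeping the variable g apart from the
    measure lets the same operator serve for a random variable under P, for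
    the normal law on the line and for a Poisson law on the integers. *)
Definition smear d (T : measurableType d) (mu : set T -> \bar R)
    (g : T -> R) phi (u : R) : \bar R :=
  \int[mu]_x phi (u + g x)%R.

Section one_measure.
Context d (T : measurableType d) (mu : probability T R) (g : T -> R).
Hypothesis mg : measurable_fun setT g.

Let measurable_shift phi u : measurable_fun setT phi ->
  measurable_fun setT (fun x => phi (u + g x)%R).
Proof.
by move=> mphi; apply: measurableT_comp => //; exact: measurable_funD.
Qed.

Lemma smear_ge0 phi u : (forall x, 0 <= phi x) -> 0 <= smear mu g phi u.
Proof. by move=> phi0; apply: integral_ge0. Qed.

Lemma measurable_smear phi : measurable_fun setT phi ->
  (forall x, 0 <= phi x) -> measurable_fun setT (smear mu g phi).
Proof.
move=> mphi phi0.
apply: (@measurable_fun_fubini_tonelli_F _ _ _ _ _ mu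
  (fun z : R * T => phi (z.1 + g z.2)%R)) => //.
apply: measurableT_comp => //; apply: measurable_funD => //.
exact: measurableT_comp.
Qed.

Lemma le_smear phi psi u : measurable_fun setT phi ->
  measurable_fun setT psi -> (forall x, 0 <= phi x) ->
  (forall x, phi x <= psi x) -> smear mu g phi u <= smear mu g psi u.
Proof.
move=> mphi mpsi phi0 le_phi; apply: ge0_le_integral => //;
  exact: measurable_shift.
Qed.

Lemma smearDc phi u (c : R) : measurable_fun setT phi ->
  (forall x, 0 <= phi x) -> (0 <= c)%R ->
  smear mu g (fun x => phi x + c%:E) u = smear mu g phi u + c%:E.
Proof.
move=> mphi phi0 c0; rewrite /smear ge0_integralD//; [|exact: measurable_shift].
by rewrite integral_cst// [X in _ * X]probability_setT mule1.
Qed.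

End one_measure.

Lemma smearC d1 (T1 : measurableType d1) (mu1 : probability T1 R) (g1 : T1 -> R)
    d2 (T2 : measurableType d2) (mu2 : probability T2 R) (g2 : T2 -> R) phi u :
  measurable_fun setT g1 -> measurable_fun setT g2 ->
  measurable_fun setT phi -> (forall x, 0 <= phi x) ->
  smear mu1 g1 (smear mu2 g2 phi) u = smear mu2 g2 (smear mu1 g1 phi) u.
Proof.
move=> mg1 mg2 mphi phi0; rewrite /smear.
transitivity (\int[mu1]_x \int[mu2]_y (phi (u + (g1 x + g2 y)))%R).
  by apply: eq_integral => x _; apply: eq_integral => y _; rewrite addrA.
rewrite (@fubini_tonelli _ _ _ _ _ mu1 mu2
  (fun z : T1 * T2 => phi (u + (g1 z.1 + g2 z.2))%R))//.
  apply: eq_integral => x _; apply: eq_integral => y _.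
  by rewrite -addrA [X in (u + X)%R]addrC.
apply: measurableT_comp => //; apply: measurable_funD => //.
by apply: measurable_funD => //; exact: measurableT_comp.
Qed.

End shifted_integral.

Section independence.
Context d (T : measurableType d) (R : realType) (P : probability T R).

(** By the uniqueness of product measures, the law of the pair is the product
    of the two laws. *)
Lemma independent_pair_integral d1 d2 (T1 : measurableType d1)
    (T2 : measurableType d2) (Y : {RV P >-> T1}) (X : {RV P >-> T2})
    (F : T1 * T2 -> \bar R) :
  independent_pair P Y X -> measurable_fun setT F -> (forall z, (0 <= F z)%E) ->
  (\int[P]_w F (Y w, X w) = \int[P]_w \int[P]_w' F (Y w, X w'))%E.
Proof.
move=> indep mF F0.
have mYX : measurable_fun setT (fun w => (Y w, X w)).
  exact: measurable_fun_pair.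
have -> : (\int[P]_w F (Y w, X w) =
    \int[pushforward P (fun w => (Y w, X w))]_z F z)%E.
  by rewrite ge0_integral_pushforward.
have lawE : forall A, measurable A -> (distribution P Y \x distribution P X)%E A =
    pushforward P (fun w => (Y w, X w)) A.
  apply: product_measure_unique => A B mA mB.
  by rewrite /pushforward -indep//; congr (P _).
have -> : (\int[pushforward P (fun w => (Y w, X w))]_z F z =
    \int[distribution P Y \x distribution P X]_z F z)%E.
  by apply: eq_measure_integral => A mA _; exact/esym/lawE.
rewrite fubini_tonelli1//= ge0_integral_distribution//.
- apply: eq_integral => w _ /=; rewrite /fubini_F ge0_integral_distribution//.
  exact: measurableT_comp.
- exact: measurable_fun_fubini_tonelli_F.
- by move=> y; apply: integral_ge0.
Qed.

End independence.

(** * Independence of partial sums *)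

Section grouping.
Local Open Scope ereal_scope.
Context d (T : measurableType d) (R : realType) (P : probability T R).

(** Rectangles form a pi-system which generates the product sigma-algebra. *)
Lemma rectangle_indep d1 d2 (T1 : measurableType d1) (T2 : measurableType d2)
    (Y : {RV P >-> T1}) (X : {RV P >-> T2}) (E : set T) :
  measurable E ->
  (forall C D, measurable C -> measurable D ->
    P (Y @^-1` C `&` X @^-1` D `&` E) = P (Y @^-1` C `&` X @^-1` D) * P E) ->
  forall Z, measurable Z ->
    P ((fun w => (Y w, X w)) @^-1` Z `&` E)
    = P ((fun w => (Y w, X w)) @^-1` Z) * P E.
Proof.
move=> mE rectE Z mZ.
have mYX : measurable_fun setT (fun w => (Y w, X w)).
  exact: measurable_fun_pair.
have PE : P E = (fine (P E))%:E by rewrite fineK// fin_num_measure.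
have PE0 : (0 <= fine (P E))%R by rewrite fine_ge0.
pose m1 : {measure set (T1 * T2) -> \bar R} :=
  pushforward (mrestr P mE) (fun w => (Y w, X w)).
pose m2 : {measure set (T1 * T2) -> \bar R} :=
  pushforward (mscale (NngNum PE0) P) (fun w => (Y w, X w)).
suff : m1 mYX Z = m2 mYX Z.
  by rewrite /m1 /m2 /= /pushforward /mrestr /mscale /= => ->; rewrite muleC -PE.
pose rect : set (set (T1 * T2)) :=
  [set C | exists A, measurable A /\ exists B, measurable B /\ C = A `*` B].
apply: (@measure_unique _ _ _ rect (fun _ => setT) _ _ _ _ (m1 mYX) (m2 mYX)) => //.
- rewrite measurable_prod_measurableType; congr (<<s _ >>).
  rewrite predeqE; split => [[A mA [B mB <-]]|[A [mA [B [mB ->]]]]].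
    by exists A; split => //; exists B.
  by exists A => //; exists B.
- move=> _ _ [X1 [mX1 [X2 [mX2 ->]]]] [Y1 [mY1 [Y2 [mY2 ->]]]].
  rewrite -setXI; exists (X1 `&` Y1); split; first exact: measurableI.
  by exists (X2 `&` Y2); split => //; exact: measurableI.
- move=> _; exists setT; split => //; exists setT; split => //.
  by rewrite setXTT.
- by rewrite bigcup_const//; exists 0%N.
- move=> _ [C [mC [D [mD ->]]]]; have := rectE C D mC mD.
  rewrite /m1 /m2 /= /pushforward /mrestr /mscale /= -PE [in RHS]muleC.
  exact.
- move=> _; rewrite /m1 /= /pushforward /mrestr setIC setIT.
  by rewrite (le_lt_trans (probability_le1 P mE))// ltry.
Qed.

Context n (X : 'I_n -> {RV P >-> R}) (X_indep : mutually_independent P X).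

Definition partial_sum (s : seq 'I_n) : {RV P >-> R} :=
  (\sum_(i <- s) (X i : {mfun T >-> R}))%R.

Lemma partial_sumE s w : partial_sum s w = (\sum_(i <- s) X i w)%R.
Proof. by rewrite /partial_sum mfun_sum. Qed.

Let ev (K : {set 'I_n}) (A : 'I_n -> set R) :=
  \bigcap_(i in [set` K]) (X i @^-1` A i).

Let measurable_ev K A : (forall i, measurable (A i)) -> measurable (ev K A).
Proof.
move=> mA; apply: fin_bigcap_measurable; first exact: finite_finset.
by move=> i _; rewrite -[X in measurable X]setTI; exact: measurable_funP.
Qed.

Let evU1 i (K : {set 'I_n}) A C : i \notin K ->
  ev (i |: K) (fun j => if j == i then C else A j) = X i @^-1` C `&` ev K A.
Proof.
move=> iK; apply/seteqP; split=> [w evw|w [Cw evw] j].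
  split; first by have := evw i; rewrite /= eqxx; apply; rewrite setU11.
  move=> j /= jK; have := evw j; rewrite /= in_setU1 jK orbT => /(_ isT).
  by case: eqP jK iK => // -> ->.
rewrite /= in_setU1; case: eqP => [-> //|_ /= jK]; exact: evw.
Qed.

Let P_evU1 i (K : {set 'I_n}) A C : i \notin K -> (forall j, measurable (A j)) ->
  measurable C -> P (X i @^-1` C `&` ev K A) = P (X i @^-1` C) * P (ev K A).
Proof.
move=> iK mA mC; rewrite -evU1// /ev !X_indep//; last first.
  by move=> j _; case: ifP.
rewrite big_setU1//= eqxx; congr (_ * _); apply: eq_bigr => j jK.
by case: eqP jK iK => // -> ->.
Qed.

(** Induction on the sum: the event that involves the partial sum over i :: s is
    a preimage of a plane set under the pair of X i and the sum over s, and on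
    rectangles the factorization is the induction hypothesis for the family
    enlarged by X i. *)
Lemma partial_sum_indep s (K : {set 'I_n}) A B :
  uniq s -> (forall i, i \in s -> i \notin K) ->
  (forall i, measurable (A i)) -> measurable B ->
  P (partial_sum s @^-1` B `&` ev K A) = P (partial_sum s @^-1` B) * P (ev K A).
Proof.
elim: s K A B => [|i s IH] K A B.
  move=> _ _ mA mB; have [B0|B0] := pselect (B 0%R).
    have -> : partial_sum [::] @^-1` B = setT.
      by apply/seteqP; split => // w _; rewrite /preimage /= partial_sumE big_nil.
    by rewrite setTI probability_setT mul1e.
  have -> : partial_sum [::] @^-1` B = set0.
    by apply/seteqP; split => // w; rewrite /preimage /= partial_sumE big_nil.
  by rewrite set0I measure0 mul0e.
move=> /= /andP[iNs us] disj mA mB.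
have iK : i \notin K by apply: disj; rewrite mem_head.
have disjK j : j \in s -> j \notin K.
  by move=> js; apply: disj; rewrite in_cons js orbT.
have addM : measurable_fun setT (fun z : R * R => (z.1 + z.2)%R).
  exact: measurable_funD.
have -> : partial_sum (i :: s) @^-1` B =
    (fun w => (X i w, partial_sum s w)) @^-1` [set z | B (z.1 + z.2)%R].
  apply/seteqP; split => w;
    by rewrite /preimage /= !partial_sumE big_cons.
apply: rectangle_indep.
- exact: measurable_ev.
- move=> C D mC mD.
  rewrite [X in P (X `&` _)]setIC -setIA -evU1// IH//; last 2 first.
  + move=> j js; rewrite in_setU1 negb_or disjK// andbT.
    by apply: contraNneq iNs => <-.
  + by move=> j; case: ifP.
  rewrite evU1// P_evU1// muleA; congr (_ * _).
  have := IH (i |: finset.set0) (fun j => if j == i then C else setT) D us.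
  rewrite (@evU1 _ finset.set0 (fun=> setT)) ?finset.in_set0//.
  have -> : ev finset.set0 (fun=> setT) = setT.
    by apply/seteqP; split => // w _ j; rewrite /= finset.in_set0.
  rewrite setIT [in X in _ -> _ = X]setIC => <- //.
  + move=> j js; rewrite finset.setU0 finset.in_set1.
    by apply: contraNneq iNs => <-.
  + by move=> j; case: ifP.
- by rewrite -[X in measurable X]setTI; exact: addM.
Qed.

Lemma independent_partial_sum i s : uniq (i :: s) ->
  independent_pair P (partial_sum s) (X i).
Proof.
move=> /= /andP[iNs us] C D mC mD.
have := @partial_sum_indep s (i |: finset.set0) (fun j => if j == i then D else setT) C us.
rewrite (@evU1 _ finset.set0 (fun=> setT)) ?finset.in_set0//.
have -> : ev finset.set0 (fun=> setT) = setT.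
  by apply/seteqP; split => // w _ j; rewrite /= finset.in_set0.
rewrite setIT => -> //.
- move=> j js; rewrite finset.setU0 finset.in_set1.
  by apply: contraNneq iNs => <-.
- by move=> j; case: ifP.
Qed.

End grouping.

(** * Normal laws *)

Section gauss.
Local Open Scope ereal_scope.
Context {R : realType}.
Implicit Types (phi : R -> \bar R) (a b v s m x u : R).
Notation mu := (@lebesgue_measure R).

(** The variance may vanish for an individual summand, and then the law has to
    be a point mass. *)
Definition gauss v : probability (measurableTypeR R) R :=
  if v == 0%R
  then (@dirac _ (measurableTypeR R) 0%R R : probability (measurableTypeR R) R)
  else (normal_prob 0 (Num.sqrt v) : probability (measurableTypeR R) R).

Definition gpdf v m x : R := normal_pdf m (Num.sqrt v) x.

Lemma gpdfE v m x : (0 < v)%R ->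
  gpdf v m x = ((Num.sqrt (v * pi *+ 2))^-1 * expR (- (x - m) ^+ 2 / (v *+ 2)))%R.
Proof.
move=> v0; rewrite /gpdf normal_pdfE ?gt_eqF ?sqrtr_gt0//.
by rewrite /normal_peak /normal_fun sqr_sqrtr ?ltW.
Qed.

Lemma measurable_gpdf v m : measurable_fun [set: R] (gpdf v m).
Proof. exact: measurable_normal_pdf. Qed.

Lemma emeasurable_gpdf v m :
  measurable_fun [set: measurableTypeR R] (fun x => (gpdf v m x)%:E).
Proof. by apply: measurableT_comp => //; exact: measurable_gpdf. Qed.

Lemma gpdf_ge0 v m x : (0 <= gpdf v m x)%R.
Proof. exact: normal_pdf_ge0. Qed.

(** The density is the Radon-Nikodym derivative up to a null set. *)
Lemma integral_gauss v phi : (0 < v)%R -> measurable_fun [set: R] phi ->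
  (forall x, 0 <= phi x) ->
  \int[gauss v]_x phi x = \int[mu]_x (phi x * (gpdf v 0 x)%:E).
Proof.
move=> v0 mphi phi0; rewrite /gauss gt_eqF//.
have s0 : Num.sqrt v != 0%R by rewrite gt_eqF ?sqrtr_gt0.
have dom := normal_prob_dominates 0 (Num.sqrt v).
rewrite -(Radon_Nikodym_SigmaFinite.change_of_variables dom)//.
apply: ae_eq_integral => //.
- apply: emeasurable_funM => //.
  exact: measurable_int (Radon_Nikodym_SigmaFinite.f_integrable dom).
- by apply: emeasurable_funM => //; exact: emeasurable_gpdf.
- apply: ae_eqe_mul2l; apply: integral_ae_eq => //.
  + exact: Radon_Nikodym_SigmaFinite.f_integrable.
  + exact: emeasurable_gpdf.
  + by move=> A _ mA; rewrite -(Radon_Nikodym_SigmaFinite.f_integral dom).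
Qed.

Lemma lebesgue_measure_shift c (A : set R) : measurable A ->
  pushforward mu ((fun x => x + c)%R : _ -> measurableTypeR R) A = mu A.
Proof.
move=> mA; pose f := (fun x => x + c)%R : measurableTypeR R -> measurableTypeR R.
have mf : measurable_fun setT f by exact: measurable_funD.
pose nu : {measure set (measurableTypeR R) -> \bar R} := pushforward mu f.
apply/esym/(@lebesgue_measure_unique _ (nu mf)) => // _ [[a b]] _ <-.
rewrite /nu /= /pushforward /f.
have -> : (fun x => x + c)%R @^-1` `]a, b]%classic = `](a - c)%R, (b - c)%R]%classic.
  by apply/seteqP; split => x /=; rewrite !in_itv /= ltrBlDr lerBrDr.
rewrite /= !lebesgue_measure_itv/= !lte_fin ltrD2r.
by case: ifP => // _; rewrite -!EFinB; congr EFin; ring.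
Qed.

Lemma integral_shift c phi : measurable_fun [set: R] phi ->
  (forall x, 0 <= phi x) -> \int[mu]_x phi (x + c)%R = \int[mu]_x phi x.
Proof.
move=> mphi phi0.
have mc : measurable_fun [set: R] ((fun x => x + c)%R : _ -> measurableTypeR R).
  exact: measurable_funD.
transitivity (\int[pushforward mu ((fun x => x + c)%R : _ -> measurableTypeR R)]_x
    phi x); first by rewrite ge0_integral_pushforward.
by apply: eq_measure_integral => A mA _; exact: lebesgue_measure_shift.
Qed.

Lemma integral_opp phi : measurable_fun [set: R] phi ->
  (forall x, 0 <= phi x) -> \int[mu]_x phi (- x)%R = \int[mu]_x phi x.
Proof.
move=> mphi phi0.
have mN : measurable_fun [set: R] (-%R : _ -> measurableTypeR R).
  exact: measurable_funN.
transitivity (\int[pushforward mu (-%R : _ -> measurableTypeR R)]_x phi x).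
  by rewrite ge0_integral_pushforward.
by apply: eq_measure_integral => A mA _; exact: lebesgue_measureN.
Qed.

(** Completing the square in x: given the sum y of two independent centred
    normal variables of variances a and b, the first one is normal with mean
    a y / (a + b) and variance a b / (a + b). *)
Lemma gpdf_prod a b x y : (0 < a)%R -> (0 < b)%R ->
  (gpdf a 0 x * gpdf b 0 (y - x) =
   gpdf (a + b) 0 y * gpdf (a * b / (a + b)) (a / (a + b) * y) x)%R.
Proof.
move=> a0 b0; have ab0 : (0 < a + b)%R by rewrite addr_gt0.
have c0 : (0 < a * b / (a + b))%R by rewrite divr_gt0 ?mulr_gt0.
rewrite !gpdfE// mulrACA [RHS]mulrACA; congr (_ * _)%R.
  rewrite -!invfM -!sqrtrM; last 2 first.
  - by rewrite mulrn_wge0// mulr_ge0 ?pi_ge0 ?ltW.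
  - by rewrite mulrn_wge0// mulr_ge0 ?pi_ge0 ?ltW.
  by congr ((Num.sqrt _)^-1)%R; field; rewrite gt_eqF.
rewrite -!expRD; congr expR; field.
by rewrite !gt_eqF.
Qed.


Lemma smear_gauss0 g phi u : measurable_fun [set: R] g ->
  measurable_fun [set: R] phi ->
  smear (gauss 0) g phi u = phi (u + g 0)%R.
Proof.
move=> mg mphi; rewrite /smear /gauss eqxx integral_dirac ?diracT ?mul1e//.
by apply: measurableT_comp => //; exact: measurable_funD.
Qed.

Lemma gauss_conv a b phi u : (0 <= a)%R -> (0 <= b)%R ->
  measurable_fun [set: R] phi -> (forall x, 0 <= phi x) ->
  smear (gauss a) id (smear (gauss b) id phi) u = smear (gauss (a + b)) id phi u.
Proof.
move=> + + mphi phi0.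
have mid : measurable_fun [set: R] (@id R) by exact: measurable_id.
have msm v : measurable_fun [set: R] (smear (gauss v) id phi).
  exact: measurable_smear mphi phi0.
have msm0 v x : 0 <= smear (gauss v) id phi x by exact: smear_ge0.
rewrite le_eqVlt => /predU1P[<- _|a0].
  by rewrite add0r; apply: etrans (smear_gauss0 u mid (msm b)) _; rewrite addr0.
rewrite le_eqVlt => /predU1P[<-|b0].
  rewrite addr0; apply: eq_integral => x _.
  by apply: etrans (smear_gauss0 _ mid mphi) _; rewrite addr0.
have ab0 : (0 < a + b)%R by rewrite addr_gt0.
have mshift psi w : measurable_fun [set: R] psi ->
    measurable_fun [set: R] (fun y => psi (w + y)%R : \bar R).
  move=> mpsi; apply: (measurableT_comp mpsi); exact: measurable_funD.
rewrite [LHS](integral_gauss a0 (mshift _ u (msm b)) (fun=> msm0 _ _)).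
rewrite [RHS](integral_gauss ab0 (mshift _ u mphi) (fun=> phi0 _)).
pose F (z : measurableTypeR R * measurableTypeR R) :=
  phi (u + z.2)%R * (gpdf a 0 z.1 * gpdf b 0 (z.2 - z.1))%:E.
transitivity (\int[mu]_x \int[mu]_y F (x, y)).
  apply: eq_integral => x _.
  rewrite [smear _ _ _ _](integral_gauss b0 (mshift _ _ mphi) (fun=> phi0 _)).
  have mG : measurable_fun [set: measurableTypeR R]
      (fun y => phi (u + x + y)%R * (gpdf b 0 y)%:E).
    apply: emeasurable_funM (emeasurable_gpdf b 0); exact: mshift.
  have G0 y : 0 <= phi (u + x + y)%R * (gpdf b 0 y)%:E.
    by rewrite mule_ge0// lee_fin gpdf_ge0.
  apply: etrans.
    by apply/esym/(ge0_integralZr mu measurableT mG) => //; rewrite lee_fin gpdf_ge0.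
  apply: etrans.
    apply/esym/(integral_shift (- x)).
    - by apply: emeasurable_funM mG _; exact: measurable_cst.
    - by move=> y; rewrite mule_ge0// lee_fin gpdf_ge0.
  apply: eq_integral => y _.
  rewrite /F /= -muleA -EFinM [(gpdf b _ _ * _)%R]mulrC.
  by congr (phi _ * _); ring.
have mF : measurable_fun setT F.
  apply: emeasurable_funM.
    by apply: (measurableT_comp (mshift _ u mphi)); exact: measurable_snd.
  apply: measurableT_comp => //; apply: measurable_funM.
    by apply: (measurableT_comp (measurable_gpdf a 0)); exact: measurable_fst.
  apply: (measurableT_comp (measurable_gpdf b 0)).
  by apply: measurable_funB; [exact: measurable_snd|exact: measurable_fst].
have F0 z : 0 <= F z by rewrite mule_ge0// lee_fin mulr_ge0// gpdf_ge0.
rewrite (fubini_tonelli F mF F0); apply: eq_integral => y _.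
rewrite /F /=; under eq_integral do rewrite gpdf_prod// EFinM muleA.
rewrite ge0_integralZl//.
- by rewrite (integral_normal_pdf _ (Num.sqrt (a * b / (a + b)))) mule1.
- exact: emeasurable_gpdf.
- by move=> x _; rewrite lee_fin gpdf_ge0.
- by rewrite mule_ge0// lee_fin gpdf_ge0.
Qed.

Lemma gauss_symm v phi u : (0 <= v)%R -> measurable_fun [set: R] phi ->
  (forall x, 0 <= phi x) ->
  smear (gauss v) -%R phi u = smear (gauss v) id phi u.
Proof.
rewrite le_eqVlt => /predU1P[<-|v0] mphi phi0.
  by rewrite !smear_gauss0// oppr0.
have mshift w : measurable_fun [set: R] (fun y => phi (w + y)%R).
  by apply: measurableT_comp => //; exact: measurable_funD.
rewrite /smear integral_gauss//; last first.
  by apply: measurableT_comp => //; apply: measurable_funB.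
rewrite integral_gauss// -integral_opp; last 2 first.
- apply: emeasurable_funM; last exact: emeasurable_gpdf.
  by apply: measurableT_comp => //; apply: measurable_funB.
- by move=> x; rewrite mule_ge0// lee_fin gpdf_ge0.
apply: eq_integral => x _; rewrite opprK; congr (_ * _%:E).
by rewrite !gpdfE// !subr0 sqrrN.
Qed.

(** A Gaussian factor turns a centred normal density into a multiple of another
    one. The case r > 1 gives the second moment and the case r < 1 gives the
    finiteness of the first one. *)
Lemma gpdf_tilt v r x : (0 < v)%R -> (0 < r)%R ->
  (expR (- ((r ^+ 2 - 1) / (2 * v) * x ^+ 2)) * gpdf v 0 x =
   r^-1 * gpdf (v / r ^+ 2) 0 x)%R.
Proof.
move=> v0 r0; have vr0 : (0 < v / r ^+ 2)%R by rewrite divr_gt0// exprn_gt0.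
rewrite !gpdfE// mulrCA [RHS]mulrA; congr (_ * _)%R.
  have -> : (v / r ^+ 2 * pi *+ 2 = v * pi *+ 2 * r^-1 ^+ 2)%R.
    by field; rewrite gt_eqF.
  rewrite sqrtrM; last by rewrite mulrn_wge0// mulr_ge0 ?pi_ge0 ?ltW.
  rewrite sqrtr_sqr ger0_norm ?invr_ge0 ?(ltW r0)// invfM invrK mulrCA mulVf ?mulr1//.
  by rewrite gt_eqF.
rewrite -expRD; congr expR; field.
by rewrite !gt_eqF.
Qed.

Lemma integral_gauss_tilt v r : (0 < v)%R -> (0 < r)%R ->
  \int[gauss v]_x (expR (- ((r ^+ 2 - 1) / (2 * v) * x ^+ 2)))%:E = (r^-1)%:E.
Proof.
move=> v0 r0; have mE : measurable_fun [set: R]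
    (fun x : R => (expR (- ((r ^+ 2 - 1) / (2 * v) * x ^+ 2)))%:E).
  apply: measurableT_comp => //; apply: measurableT_comp => //.
  by apply: measurableT_comp => //; apply: measurable_funM.
rewrite (integral_gauss v0 mE); last by move=> x; rewrite lee_fin expR_ge0.
under eq_integral => x _ do rewrite -EFinM gpdf_tilt// EFinM.
rewrite ge0_integralZl//.
- by rewrite (integral_normal_pdf _ (Num.sqrt (v / r ^+ 2))) mule1.
- exact: emeasurable_gpdf.
- by move=> x _; rewrite lee_fin gpdf_ge0.
- by rewrite lee_fin invr_ge0 ltW.
Qed.

(** Integrating x^2 >= (1 - exp (- s x^2)) / s with s = (r^2 - 1) / (2 v) bounds
    the second moment from below by 2 v / (r (r + 1)), which tends to v as r
    decreases to 1. Only this lower bound matters, and it spares an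
    integration by parts. *)
Lemma gauss_second_moment v : (0 <= v)%R ->
  v%:E <= \int[gauss v]_x (x ^+ 2)%:E.
Proof.
rewrite le_eqVlt => /predU1P[<-|v0].
  by apply: integral_ge0 => x _; rewrite lee_fin sqr_ge0.
have mX2 : measurable_fun [set: R] (fun x => (x ^+ 2)%:E).
  by apply: measurableT_comp => //; exact: measurable_funX.
have X20 x : 0 <= (x ^+ 2)%:E by rewrite lee_fin sqr_ge0.
have key r : (1 < r)%R ->
    (2 * v / (r * (r + 1)))%:E <= \int[gauss v]_x (x ^+ 2)%:E.
  move=> r1; have r0 : (0 < r)%R by rewrite (lt_trans _ r1).
  have r20 : (0 < r ^+ 2 - 1)%R by rewrite subr_gt0 exprn_egt1.
  pose s := ((r ^+ 2 - 1) / (2 * v))%R.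
  have s0 : (0 < s)%R by rewrite divr_gt0// mulr_gt0.
  have mE : measurable_fun [set: R] (fun x => (s^-1 * expR (- (s * x ^+ 2)))%:E).
    apply: measurableT_comp => //; apply: measurable_funM => //.
    apply: measurableT_comp => //; apply: measurableT_comp => //.
    by apply: measurable_funM => //; exact: measurable_funX.
  have E0 x : 0 <= (s^-1 * expR (- (s * x ^+ 2)))%:E.
    by rewrite lee_fin mulr_ge0 ?expR_ge0 ?invr_ge0 ?ltW.
  have intE : \int[gauss v]_x (s^-1 * expR (- (s * x ^+ 2)))%:E = (s * r)^-1%:E.
    have mE1 : measurable_fun [set: measurableTypeR R]
        (fun x : R => (expR (- (s * x ^+ 2)))%:E).
      apply: measurableT_comp => //; apply: measurableT_comp => //.
      by apply: measurableT_comp => //; apply: measurable_funM.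
    under eq_integral do rewrite EFinM.
    rewrite (ge0_integralZl _ measurableT mE1).
    - by rewrite (integral_gauss_tilt v0 r0) -EFinM -(invfM s r).
    - by move=> x _; rewrite lee_fin expR_ge0.
    - by rewrite lee_fin invr_ge0 ltW.
  have : (s^-1)%:E <= \int[gauss v]_x (x ^+ 2)%:E + (s * r)^-1%:E.
    rewrite -intE -ge0_integralD//.
    have -> : (s^-1)%:E = \int[gauss v]_x (s^-1)%:E.
      by rewrite integral_cst// [X in _ * X]probability_setT mule1.
    apply: ge0_le_integral => //.
    all: try (by move=> x _; rewrite lee_fin invr_ge0 ltW).
    all: try exact: emeasurable_funD.
    move=> x _; rewrite -EFinD lee_fin.
    have sV : (s * s^-1 = 1)%R by rewrite mulfV// gt_eqF.
    rewrite -(ler_pM2l s0) [leRHS]mulrDr (mulrA s s^-1%R) sV mul1r.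
    by have := expR_ge1Dx (- (s * x ^+ 2))%R; lra.
  rewrite -leeBlDr// -EFinB; congr (_%:E <= _).
  have r10 : (0 < r + 1)%R by rewrite addr_gt0.
  by rewrite /s; field; rewrite !gt_eqF.
(* this r gives 2 / (r (r + 1)) >= 1 - 2 (r - 1) = 1 - e / v *)
apply/lee_addgt0Pr => e e0; set r := (1 + e / (2 * v))%R.
have r1 : (1 < r)%R by rewrite ltrDl divr_gt0// mulr_gt0.
apply: le_trans (leeD2r _ (key r r1)).
rewrite -EFinD lee_fin -lerBlDr ler_pdivlMr; last by nra.
have -> : (e = 2 * v * (r - 1))%R.
  by rewrite /r; field; rewrite gt_eqF.
have -> : ((v - 2 * v * (r - 1)) * (r * (r + 1)) = v * ((3 - 2 * r) * (r * (r + 1))))%R by ring.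
have -> : (2 * v = v * 2)%R by ring.
rewrite ler_pM2l//.
have : (0 <= (r - 1) * (r - 1))%R by rewrite mulr_ge0 ?subr_ge0 ?ltW.
by nra.
Qed.

(** Because |x| <= 1 + x^2 <= (1 + 4 v) exp (x^2 / (4 v)). *)
Lemma gauss_abs_moment v : (0 <= v)%R -> \int[gauss v]_x `|x|%:E < +oo.
Proof.
rewrite le_eqVlt => /predU1P[<-|v0].
  rewrite /gauss eqxx integral_dirac ?diracT ?mul1e ?normr0 ?ltry//.
  by apply: measurableT_comp => //; exact: measurableT_comp.
(* tilting with r^2 = 1/2 doubles the variance *)
have r0 : (0 < Num.sqrt (2^-1) :> R)%R by rewrite sqrtr_gt0 invr_gt0.
have tilt := integral_gauss_tilt v0 r0.
have rE : ((Num.sqrt (2^-1) ^+ 2 - 1) / (2 * v) = - (4 * v)^-1 :> R)%R.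
  by rewrite sqr_sqrtr ?invr_ge0//; field; rewrite gt_eqF.
have mE1 : measurable_fun [set: measurableTypeR R]
    (fun x : R => (expR (- (- (4 * v)^-1 * x ^+ 2)))%:E).
  apply: measurableT_comp => //; apply: measurableT_comp => //.
  by apply: measurableT_comp => //; apply: measurable_funM.
have E10 (x : R) : 0 <= (expR (- (- (4 * v)^-1 * x ^+ 2)))%:E.
  by rewrite lee_fin expR_ge0.
have k0 : 0 <= (1 + 4 * v)%:E by rewrite lee_fin addr_ge0// mulr_ge0// ltW.
apply: (@le_lt_trans _ _ (\int[gauss v]_x
    ((1 + 4 * v)%:E * (expR (- (- (4 * v)^-1 * x ^+ 2)))%:E))).
  apply: (ge0_le_integral _ measurableT).
  - by move=> x _; rewrite lee_fin.
  - by apply: measurableT_comp => //; exact: measurableT_comp.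
  - exact: measurable_funeM.
  - move=> x _; rewrite -EFinM lee_fin mulNr opprK.
    set q := ((4 * v)^-1 * x ^+ 2)%R.
    have qE : (x ^+ 2 = 4 * v * q)%R by rewrite /q; field; rewrite gt_eqF.
    have q0 : (0 <= q)%R by rewrite mulr_ge0 ?sqr_ge0 ?invr_ge0 ?mulr_ge0 ?ltW.
    have h1 : (`|x| <= 1 + x ^+ 2)%R.
      rewrite -[(x ^+ 2)%R]real_normK ?num_real//.
      by have := sqr_ge0 (`|x| - 1)%R; nra.
    apply: (le_trans h1); rewrite qE.
    have := expR_ge1Dx q; nra.
rewrite (ge0_integralZl _ measurableT mE1 (fun _ _ => E10 _) k0).
by move: tilt; rewrite rE => ->; rewrite -EFinM ltry.
Qed.

End gauss.

(** * Poisson laws *)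

Section poisson_law.
Local Open Scope ereal_scope.
Context {R : realType}.
Implicit Types (phi : R -> \bar R) (a b t y u : R) (k j m : nat).

Definition pois t : probability nat R := poisson_prob t 0%N.

(** Unlike [poisson_pmf], this is also correct for t = 0. *)
Definition pois_weight t k : R := (t ^+ k / k`!%:R * expR (- t))%R.

Lemma pois_weight_ge0 t k : (0 <= t)%R -> (0 <= pois_weight t k)%R.
Proof. by move=> t0; rewrite !mulr_ge0 ?exprn_ge0 ?expR_ge0 ?invr_ge0. Qed.

Lemma pois_set1 t k : (0 <= t)%R -> pois t [set k] = (pois_weight t k)%:E.
Proof.
rewrite le_eqVlt => /predU1P[<-|t0].
  rewrite /pois /= /poisson_prob ltxx diracE /pois_weight oppr0 expR0 mulr1.
  case: k => [|k]; first by rewrite mem_set// expr0 fact0 divr1.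
  by rewrite memNset// expr0n mul0r.
rewrite /pois /= /poisson_prob t0 esum_set1 /poisson_pmf t0//.
exact: pois_weight_ge0 (ltW t0).
Qed.

Lemma integral_pois t (g : nat -> \bar R) : (0 <= t)%R -> (forall k, 0 <= g k) ->
  \int[pois t]_k g k = \sum_(k <oo) g k * (pois_weight t k)%:E.
Proof.
move=> t0 g0.
transitivity (\int[pois t]_x \sum_(k <oo) g k * (\1_[set k] x)%:E).
  apply: eq_integral => x _.
  rewrite (nneseriesD1 (n := x))//=; last first.
    by move=> k _; rewrite mule_ge0.
  rewrite indicE mem_set// mule1 eseries0 ?adde0// => k _ kx.
  by rewrite indicE memNset ?mule0//= => xk; rewrite xk eqxx in kx.
rewrite integral_nneseries//; last by move=> k x _; rewrite mule_ge0.
apply: eq_eseriesr => k _; rewrite ge0_integralZl//.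
by rewrite integral_indic// setIT; congr (_ * _); exact: pois_set1.
Qed.

Lemma nneseries_shift (g : nat -> \bar R) j : (forall k, 0 <= g k) ->
  \sum_(k <oo) g k = \sum_(m <oo) if (j <= m)%N then g (m - j)%N else 0.
Proof.
move=> g0; rewrite [RHS](nneseries_split 0%N j); last first.
  by move=> k _; case: ifP.
rewrite big_nat_cond big1 ?add0e; last first.
  by move=> i /andP[/andP[_ ij] _]; rewrite leqNgt ij.
rewrite add0n -(@nneseries_addn _ (fun m => if (j <= m)%N then g (m - j)%N else 0)).
  by apply: eq_eseriesr => i _; rewrite leq_addl addnK.
by move=> i; case: ifP.
Qed.

Lemma pois_ffact_moment t r : (0 <= t)%R ->
  \int[pois t]_k ((k ^_ r)%:R)%:E = (t ^+ r)%:E.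
Proof.
move=> t0; rewrite integral_pois//.
transitivity (\sum_(m <oo) if (r <= m)%N
    then (t ^+ r)%:E * (pois_weight t (m - r))%:E else 0).
  apply: eq_eseriesr => m _; case: ifPn => rm; last first.
    by rewrite ffact_small ?mul0e// ltnNge.
  rewrite -!EFinM; congr EFin; rewrite /pois_weight -{2}(subnKC rm) exprD.
  rewrite -(ffact_fact rm) natrM; field.
  by rewrite !pnatr_eq0 -!lt0n fact_gt0 ffact_gt0 rm.
rewrite -(@nneseries_shift (fun k => (t ^+ r)%:E * (pois_weight t k)%:E)); last first.
  by move=> k; rewrite -EFinM lee_fin mulr_ge0 ?exprn_ge0 ?pois_weight_ge0.
rewrite nneseriesZl; last by move=> k _; rewrite lee_fin pois_weight_ge0.
have := @integral_pois t (fun=> 1) t0 (fun=> lee01).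
rewrite integral_cst// mul1e [X in X = _]probability_setT.
by under eq_eseriesr do rewrite mul1e; move=> <-; rewrite mule1.
Qed.

Definition pois_jump y t k : R := (y * (k%:R - t))%R.

Lemma measurable_pois_jump y t : measurable_fun setT (pois_jump y t).
Proof. by []. Qed.

Lemma pois_weight_conv a b m :
  (\sum_(j < m.+1) pois_weight a j * pois_weight b (m - j) =
   pois_weight (a + b) m)%R.
Proof.
rewrite /pois_weight addrC exprDn opprD expRD.
transitivity ((\sum_(i < m.+1) (b ^+ (m - i) * a ^+ i) / (m - i)`!%:R / i`!%:R) *
              (expR (- b) * expR (- a)))%R.
  rewrite mulr_suml; apply: eq_bigr => i _; field.
  by rewrite !pnatr_eq0 -!lt0n !fact_gt0.
congr (_ * _)%R; rewrite mulr_suml; apply: eq_bigr => i _.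
have im : (i <= m)%N by rewrite -ltnS.
rewrite -(bin_fact im) !natrM -mulr_natr; field.
by rewrite !pnatr_eq0 -!lt0n !fact_gt0 bin_gt0 im.
Qed.

(** The double series over (j, k) is summed along the diagonals j + k = m, where
    the weights add up by the binomial theorem. *)
Lemma pois_conv y a b phi u : (0 <= a)%R -> (0 <= b)%R ->
  (forall x, 0 <= phi x) ->
  smear (pois a) (pois_jump y a) (smear (pois b) (pois_jump y b) phi) u =
  smear (pois (a + b)) (pois_jump y (a + b)) phi u.
Proof.
move=> a0 b0 phi0; rewrite /smear.
rewrite integral_pois//; last by move=> k; exact: integral_ge0.
rewrite integral_pois ?addr_ge0//.
pose H m := phi (u + pois_jump y (a + b) m)%R.
pose F j m := H m * (pois_weight a j * pois_weight b (m - j))%:E.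
have F0 j m : 0 <= F j m.
  by rewrite mule_ge0 ?phi0// lee_fin mulr_ge0 ?pois_weight_ge0.
transitivity (\sum_(j <oo) \sum_(m <oo) if (j <= m)%N then F j m else 0).
  apply: eq_eseriesr => j _; rewrite integral_pois// muleC -nneseriesZl; last first.
    by move=> k _; rewrite mule_ge0// lee_fin pois_weight_ge0.
  rewrite (nneseries_shift j); last first.
    by move=> k; rewrite !mule_ge0// lee_fin pois_weight_ge0.
  apply: eq_eseriesr => m _; case: ifPn => // jm.
  rewrite /F /H muleCA EFinM; congr (phi _ * _).
  by rewrite -addrA -mulrDr natrB//; congr (_ + _ * _)%R; ring.
rewrite nneseries_interchange; last by move=> i j; case: ifP.
apply: eq_eseriesr => m _.
rewrite (nneseries_split 0%N m.+1); last by move=> k _; case: ifP.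
rewrite eseries0 ?adde0; last first.
  by move=> k; rewrite add0n => mk _; rewrite leqNgt mk.
rewrite add0n big_mkord.
under eq_bigr => i _ do rewrite -ltnS ltn_ord.
rewrite /F -ge0_sume_distrr; last first.
  by move=> j _; rewrite lee_fin mulr_ge0 ?pois_weight_ge0.
by rewrite sumEFin pois_weight_conv.
Qed.

End poisson_law.

(** * Lower bound for the Gaussian-Poisson law *)

Section lower_bounds.
Local Open Scope ereal_scope.
Context {R : realType}.
Implicit Types (t u v w y : R) (k r : nat).

(** The minorant p may change sign, so it is compared with F through its
    positive part. *)
Lemma le_integral_minorant d (T : measurableType d) (mu : {measure set T -> \bar R})
    (p : T -> R) (F : T -> \bar R) :
  mu.-integrable setT (EFin \o p) -> measurable_fun setT F ->
  (forall x, 0 <= F x) -> (forall x, (p x)%:E <= F x) ->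
  \int[mu]_x (p x)%:E <= \int[mu]_x F x.
Proof.
move=> ip mF F0 pF; apply: (@le_trans _ _ (\int[mu]_x ((EFin \o p)^\+ x))).
  apply: le_integral => //; first exact: integrable_funepos.
  by move=> x _; rewrite funeposE le_max lexx.
apply: ge0_le_integral => //.
  by apply: measurable_funepos; exact: measurable_int ip.
by move=> x _; rewrite funeposE ge_max pF F0.
Qed.

Lemma integrable_ffact t r : (0 <= t)%R ->
  (pois t).-integrable setT (fun k => (k ^_ r)%:R%:E).
Proof.
move=> t0; apply/integrableP; split => //.
under eq_integral do rewrite gee0_abs ?lee_fin//.
by rewrite pois_ffact_moment// ltry.
Qed.

Lemma integrable_ffact_poly t (c : nat -> R) n : (0 <= t)%R ->
  (pois t).-integrable setT (fun k => (\sum_(r < n) c r * (k ^_ r)%:R)%:E).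
Proof.
move=> t0; apply: (@eq_integrable _ _ _ _ _ measurableT
    (fun k => \sum_(r < n) (c r)%:E * (k ^_ r)%:R%:E)).
  by move=> k _; rewrite -sumEFin; apply: eq_bigr => r _; rewrite EFinM.
apply: integrable_sum => // r _; apply: integrableZl => //.
exact: integrable_ffact.
Qed.

Lemma integral_ffact_poly t (c : nat -> R) n : (0 <= t)%R ->
  \int[pois t]_k (\sum_(r < n) c r * (k ^_ r)%:R)%:E =
  (\sum_(r < n) c r * t ^+ r)%:E.
Proof.
move=> t0.
transitivity (\int[pois t]_k \sum_(r < n) (c r)%:E * (k ^_ r)%:R%:E).
  by apply: eq_integral => k _; rewrite -sumEFin; apply: eq_bigr => r _; rewrite EFinM.
rewrite integral_sum//; last first.
  by move=> r; apply: integrableZl => //; exact: integrable_ffact.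
rewrite -sumEFin; apply: eq_bigr => r _.
by rewrite integralZl ?pois_ffact_moment//; exact: integrable_ffact.
Qed.

Lemma natr_ffactS k r : ((k ^_ r.+1)%:R = (k ^_ r)%:R * (k%:R - r%:R) :> R)%R.
Proof.
rewrite ffactnSr natrM; have [rk|kr] := leqP r k; first by rewrite natrB.
by rewrite ffact_small// !mul0r.
Qed.

(** By symmetry of the normal law, twice the right-hand side is the expectation
    of psi (w + g) + psi (w - g). *)
Lemma le_gauss_symm v w (psi : R -> R) (a c : R) : (0 <= v)%R ->
  (0 <= a)%R -> (0 <= c)%R ->
  measurable_fun [set: R] psi -> (forall x, 0 <= psi x)%R ->
  (forall g, 2 * a + c * g ^+ 2 <= psi (w + g) + psi (w - g))%R ->
  (a + v / 2 * c)%:E <= smear (gauss v) id (EFin \o psi) w.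
Proof.
move=> v0 a0 c0 mpsi psi0 sym.
have mE : measurable_fun [set: R] (EFin \o psi) by exact: measurableT_comp.
have E0 x : 0 <= (EFin \o psi) x by rewrite lee_fin.
have mg (g : R -> R) : measurable_fun [set: R] g ->
    measurable_fun [set: measurableTypeR R] (fun x => (psi (w + g x))%:E).
  by move=> mg; apply: (measurableT_comp mE); exact: measurable_funD.
set s := smear _ _ _ _.
have s0 : 0 <= s by exact: integral_ge0.
have : (2 * a + c * v)%:E <= s + s.
  rewrite -{2}/s /s -{2}(gauss_symm w v0 mE E0) /smear.
  rewrite -ge0_integralD; last 5 first.
  - exact: measurableT.
  - by move=> x _; rewrite lee_fin.
  - exact: (mg id (@measurable_id _ _ _)).
  - by move=> x _; rewrite lee_fin.
  - exact: (mg -%R (measurable_funN (@measurable_id _ _ _))).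
  have mX2 : measurable_fun [set: measurableTypeR R] (fun x : R => (x ^+ 2)%:E).
    by apply: measurableT_comp => //; exact: measurable_funX.
  have X20 (x : R) : 0 <= (x ^+ 2)%:E by rewrite lee_fin sqr_ge0.
  have mcX2 : measurable_fun [set: measurableTypeR R]
      (fun x : R => c%:E * (x ^+ 2)%:E) by exact: measurable_funeM.
  have cX20 (x : R) : 0 <= c%:E * (x ^+ 2)%:E by rewrite mule_ge0.
  have a20 : 0 <= (2 * a)%:E by rewrite lee_fin mulr_ge0.
  apply: (@le_trans _ _ (\int[gauss v]_x ((2 * a)%:E + c%:E * (x ^+ 2)%:E))).
    rewrite (ge0_integralD _ measurableT (fun _ _ => a20) (measurable_cst _)
      (fun _ _ => cX20 _) mcX2).
    rewrite (integral_cst _ measurableT) [X in _ * X]probability_setT mule1.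
    rewrite (ge0_integralZl_EFin _ measurableT (fun _ _ => X20 _) mX2 c0).
    by rewrite EFinD leeD2l// EFinM lee_wpmul2l// gauss_second_moment.
  apply: (ge0_le_integral _ measurableT).
  - by move=> x _; rewrite adde_ge0.
  - exact: emeasurable_funD (measurable_cst _) mcX2.
  - apply: emeasurable_funD; first exact: (mg id (@measurable_id _ _ _)).
    exact: (mg -%R (measurable_funN (@measurable_id _ _ _))).
  - by move=> x _; rewrite -EFinM -!EFinD lee_fin; exact: sym.
case: s s0 => [r| |]//.
- by move=> _; rewrite -EFinD !lee_fin; lra.
- by move=> _ _; rewrite leey.
Qed.

Section C2.
Context (f f1 f2 : R -> R).
Context (df : forall x : R, has_der f x (f1 x))
  (df1 : forall x : R, has_der f1 x (f2 x))
  (f2_ge0 : forall x : R, (0 <= f2 x)%R)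
  (f2_conv : forall a b t : R, (0 <= t)%R -> (t <= 1)%R ->
     (f2 (t * a + (1 - t) * b) <= t * f2 a + (1 - t) * f2 b)%R).

Lemma has_der_measurable (g g1 : R -> R) : (forall x : R, has_der g x (g1 x)) ->
  measurable_fun [set: R] g.
Proof.
move=> dg; apply: continuous_measurable_fun => x.
exact/differentiable_continuous/derivable1_diffP/(@ex_derive _ _ _ _ _ _ _ (dg x)).
Qed.

Context (f_ge0 : forall x : R, (0 <= f x)%R).

(** The cubic of [ge_hermite3] is integrated against the Poisson law; written in
    falling factorials of k its coefficients are c 0, ..., c 3. Because the
    central moments are 0, t, t, the terms in f1 (u + y) cancel. *)
Lemma le_pois_smear t y u : (0 <= t)%R -> (0 <= y)%R ->
  (f u + t * jump f f1 y u)%:E <= smear (pois t) (pois_jump y t) (EFin \o f) u.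
Proof.
move=> t0 y0.
(* c2 and c3 are the coefficients of x^2 and x^3, where x = k - t *)
pose c2 := (- 3 * f u - 2 * (y * f1 u) + 3 * f (u + y) - y * f1 (u + y))%R.
pose c3 := (2 * f u + y * f1 u - 2 * f (u + y) + y * f1 (u + y))%R.
pose c (r : nat) : R := nth 0%R [::
  (f u - y * f1 u * t + c2 * t ^+ 2 - c3 * t ^+ 3)%R;
  (y * f1 u + c2 * (1 - 2 * t) + c3 * (1 - 3 * t + 3 * t ^+ 2))%R;
  (c2 + c3 * (3 - 3 * t))%R; c3] r.
have -> : (f u + t * jump f f1 y u)%:E =
    \int[pois t]_k (\sum_(r < 4) c r * (k ^_ r)%:R)%:E.
  rewrite integral_ffact_poly//; congr EFin.
  by rewrite !big_ord_recr big_ord0 /= /c /= /jump /c2 /c3; ring.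
apply: le_integral_minorant.
- exact: integrable_ffact_poly.
- by [].
- by move=> k; rewrite lee_fin.
- move=> k; rewrite lee_fin /= /pois_jump [(y * _)%R]mulrC.
  apply: le_trans (ge_hermite3 df df1 f2_conv u (k%:R - t) y0).
  rewrite !big_ord_recr big_ord0 /= /c /= !natr_ffactS ffactn0 /c2 /c3.
  by rewrite le_eqVlt; apply/orP; left; apply/eqP; ring.
Qed.

(** The Poisson bound is applied inside and the Gaussian one outside; as the
    jump term satisfies the midpoint inequality, it survives the Gaussian
    integration. *)
Lemma le_gauss_pois_smear v t y u : (0 <= v)%R -> (0 <= t)%R -> (0 <= y)%R ->
  (f u + v / 2 * f2 u + t * jump f f1 y u)%:E <=
  smear (gauss v) id (smear (pois t) (pois_jump y t) (EFin \o f)) u.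
Proof.
move=> v0 t0 y0.
have mf := has_der_measurable df.
have mf1 := has_der_measurable df1.
have E0 x : 0 <= (EFin \o f) x by rewrite lee_fin.
have mE : measurable_fun [set: R] (EFin \o f) by exact: measurableT_comp.
have j0 x := jump_ge0 df df1 f2_ge0 y x.
pose psi x := (f x + t * jump f f1 y x)%R.
have psi0 x : (0 <= psi x)%R by rewrite addr_ge0// mulr_ge0.
have mpsi : measurable_fun [set: R] psi.
  apply: measurable_funD => //; apply: measurable_funM => //.
  rewrite /jump; apply: measurable_funB; last exact: measurable_funM.
  apply: measurable_funB => //; apply: (measurableT_comp mf).
  exact: measurable_funD.
apply: (@le_trans _ _ (smear (gauss v) id (EFin \o psi) u)).
  rewrite addrAC.
  apply: (le_gauss_symm v0 (psi0 u) (f2_ge0 u) mpsi psi0) => g.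
  have h1 := ge_midpoint df df1 f2_conv u g.
  have h2 := ge_midpoint_jump df df1 f2_conv u g y0.
  have : (0 <= t * (jump f f1 y (u + g) + jump f f1 y (u - g) - 2 * jump f f1 y u))%R.
    by rewrite mulr_ge0// subr_ge0.
  by rewrite /psi; nra.
apply: le_smear.
- exact: measurable_id.
- exact: measurableT_comp.
- by apply: (measurable_smear (pois t)) mE E0.
- by move=> x; rewrite lee_fin.
- by move=> x; exact: le_pois_smear.
Qed.

End C2.

End lower_bounds.

(** * Upper bound for one summand *)

Section one_variable.
Local Open Scope ereal_scope.
Context {R : realType} (f f1 f2 : R -> R).
Context (df : forall x : R, has_der f x (f1 x))
  (df1 : forall x : R, has_der f1 x (f2 x))
  (f2_ge0 : forall x : R, (0 <= f2 x)%R)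
  (f2_homo : {homo f2 : x y / (x <= y)%R})
  (f2_conv : forall a b t : R, (0 <= t)%R -> (t <= 1)%R ->
     (f2 (t * a + (1 - t) * b) <= t * f2 a + (1 - t) * f2 b)%R)
  (f_ge0 : forall x : R, (0 <= f x)%R).
Context d (T : measurableType d) (P : probability T R) (X : T -> R).
Context (mX : measurable_fun setT X) (y m s2 b3 : R).
Context (y_gt0 : (0 < y)%R) (X_int : P.-integrable setT (EFin \o X))
  (X_m : \int[P]_w (X w)%:E = m%:E)
  (X_s2 : \int[P]_w (X w ^+ 2)%:E = s2%:E)
  (X_b3 : \int[P]_w (Num.max 0 (X w) ^+ 3)%:E = b3%:E)
  (X_le : {ae P, forall w, (X w <= y)%R}).

(** The Taylor bound only holds where X <= y, hence both integrals are first
    restricted to the complement of a null set. *)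
Lemma smear_le_taylor u :
  smear P X (EFin \o f) u <=
  (f u + f1 u * m + s2 / 2 * f2 u + b3 / y ^+ 3 * rem2 f f1 f2 u y)%:E.
Proof.
pose rhs w := (f u + f1 u * X w + f2 u / 2 * X w ^+ 2 +
  rem2 f f1 f2 u y / y ^+ 3 * Num.max 0 (X w) ^+ 3)%R.
have mX2 : measurable_fun setT (fun w => (X w ^+ 2)%R) by exact: measurable_funX.
have mX3 : measurable_fun setT (fun w => (Num.max 0 (X w) ^+ 3)%R).
  by apply: measurable_funX; exact: measurable_maxr.
have iX2 : P.-integrable setT (fun w => (X w ^+ 2)%:E).
  apply/integrableP; split; first exact: measurableT_comp.
  under eq_integral do rewrite gee0_abs ?lee_fin ?sqr_ge0//.
  by rewrite X_s2 ltry.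
have p3 w : (0 <= Num.max 0 (X w) ^+ 3)%R by rewrite exprn_ge0// le_max lexx.
have iX3 : P.-integrable setT (fun w => (Num.max 0 (X w) ^+ 3)%:E).
  apply/integrableP; split; first exact: measurableT_comp.
  under eq_integral do rewrite gee0_abs ?lee_fin//.
  by rewrite X_b3 ltry.
have ic : P.-integrable setT (fun=> (f u)%:E).
  exact: finite_measure_integrable_cst.
have i1 := integrableZl measurableT (f1 u) X_int.
have i2 := integrableZl measurableT (f2 u / 2)%R iX2.
have i3 := integrableZl measurableT (rem2 f f1 f2 u y / y ^+ 3)%R iX3.
have ic1 := integrableD measurableT ic i1.
have ic12 := integrableD measurableT ic1 i2.
have irhs : P.-integrable setT (EFin \o rhs).
  apply: eq_integrable (integrableD measurableT ic12 i3) => //.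
have rhsE : \int[P]_w (rhs w)%:E =
    (f u + f1 u * m + s2 / 2 * f2 u + b3 / y ^+ 3 * rem2 f f1 f2 u y)%:E.
  transitivity (\int[P]_w ((f u)%:E + (f1 u)%:E * (X w)%:E
    + (f2 u / 2)%:E * (X w ^+ 2)%:E
    + (rem2 f f1 f2 u y / y ^+ 3)%:E * (Num.max 0 (X w) ^+ 3)%:E)).
    by [].
  rewrite (integralD measurableT ic12 i3) (integralD measurableT ic1 i2).
  rewrite (integralD measurableT ic i1) (integralZl measurableT X_int).
  rewrite (integralZl measurableT iX2) (integralZl measurableT iX3).
  rewrite X_m X_s2 X_b3 integral_cst// [X in _ * X]probability_setT mule1.
  by rewrite -!EFinM -!EFinD; congr EFin; ring.
have [N [mN PN0 subN]] := X_le.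
have mf : measurable_fun setT (fun w => (f (u + X w))%:E).
  apply: measurableT_comp => //; apply: (measurableT_comp (has_der_measurable df)).
  exact: measurable_funD.
rewrite /smear -rhsE.
rewrite (ge0_negligible_integral mN measurableT mf _ PN0); last first.
  by move=> w _; rewrite lee_fin.
rewrite [leRHS](negligible_integral mN measurableT irhs PN0).
have mD : measurable (setT `\` N) by exact: measurableD.
apply: ge0_le_integral => //.
- by move=> w _; rewrite lee_fin.
- exact: measurable_funS mf.
- by apply: measurable_funS (measurable_int _ irhs).
- move=> w [_ Nw]; have Xy : (X w <= y)%R.
    by apply: contrapT => Xy; apply: Nw; apply: subN.
  rewrite lee_fin; apply: le_trans (taylor3_le df df1 f2_homo f2_conv u y_gt0 Xy) _.
  by rewrite /rhs le_eqVlt; apply/orP; left; apply/eqP; field; rewrite gt_eqF.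
Qed.

(** Replacing the third moment by a larger b is allowed since [rem2] is
    nonnegative. As [rem2] is [jump] minus f2 u y^2 / 2, the Taylor bound is
    then the generator with variance s2 - b / y and rate b / y^3. The constant
    c bounds the negative part of f1. *)
Lemma smear_le_gauss_pois (b c : R) u :
  (forall x, (- c <= f1 x)%R) -> (m <= 0)%R -> (b3 <= b)%R -> (0 <= b)%R ->
  (b <= y * s2)%R ->
  smear P X (EFin \o f) u <=
  smear (gauss (s2 - b / y)) id
    (smear (pois (b / y ^+ 3)) (pois_jump y (b / y ^+ 3)) (EFin \o f)) u
  + (c * - m)%:E.
Proof.
move=> f1c m0 b3b b0 bs.
have v0 : (0 <= s2 - b / y)%R by rewrite subr_ge0 ler_pdivrMr// mulrC.
have t0 : (0 <= b / y ^+ 3)%R by rewrite divr_ge0// exprn_ge0// ltW.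
apply: le_trans (smear_le_taylor u) _.
apply: (@le_trans _ _ ((f u + (s2 - b / y) / 2 * f2 u
    + b / y ^+ 3 * jump f f1 y u)%:E + (c * - m)%:E)); last first.
  rewrite leeD2r//.
  exact: (le_gauss_pois_smear df df1 f2_ge0 f2_conv f_ge0 u v0 t0 (ltW y_gt0)).
rewrite -EFinD lee_fin.
have h1 : (f1 u * m <= c * - m)%R by have := f1c u; nra.
have h2 : (b3 / y ^+ 3 * rem2 f f1 f2 u y <= b / y ^+ 3 * rem2 f f1 f2 u y)%R.
  apply: ler_wpM2r; first exact: (rem2_ge0 df df1 f2_homo u (ltW y_gt0)).
  by apply: ler_wpM2r => //; rewrite invr_ge0 exprn_ge0// ltW.
have -> : ((s2 - b / y) / 2 * f2 u =
    s2 / 2 * f2 u - b / y ^+ 3 * (f2 u * y ^+ 2 / 2))%R.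
  by field; rewrite gt_eqF.
move: h2; rewrite /rem2 /jump.
set q := (b / y ^+ 3)%R; set q3 := (b3 / y ^+ 3)%R.
by lra.
Qed.

End one_variable.

(** * Exchange of the summands *)

Section gauss_pois_operator.
Local Open Scope ereal_scope.
Context {R : realType} (y : R).
Implicit Types (phi : R -> \bar R) (u v t : R).

Definition gauss_pois v t phi : R -> \bar R :=
  smear (gauss v) id (smear (pois t) (pois_jump y t) phi).

Let mid : measurable_fun [set: measurableTypeR R] (@id R).
Proof. exact: measurable_id. Qed.

Let mjump t : measurable_fun [set: nat] (pois_jump y t).
Proof. by []. Qed.

Lemma measurable_gauss_pois v t phi : measurable_fun [set: R] phi ->
  (forall x, 0 <= phi x) -> measurable_fun [set: R] (gauss_pois v t phi).
Proof.
move=> mphi phi0; apply: (measurable_smear _ mid).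
  exact: (measurable_smear _ (mjump t) mphi phi0).
by move=> x; exact: smear_ge0.
Qed.

Lemma gauss_pois_ge0 v t phi u : (forall x, 0 <= phi x) ->
  0 <= gauss_pois v t phi u.
Proof. by move=> phi0; apply: smear_ge0 => x; exact: smear_ge0. Qed.

Lemma gauss_poisD v1 t1 v2 t2 phi u : (0 <= v1)%R -> (0 <= t1)%R ->
  (0 <= v2)%R -> (0 <= t2)%R ->
  measurable_fun [set: R] phi -> (forall x, 0 <= phi x) ->
  gauss_pois v1 t1 (gauss_pois v2 t2 phi) u =
  gauss_pois (v1 + v2) (t1 + t2) phi u.
Proof.
move=> v10 t10 v20 t20 mphi phi0; rewrite /gauss_pois.
have p0 t x : 0 <= smear (pois t) (pois_jump y t) phi x by exact: smear_ge0.
have mp t := measurable_smear (pois t) (mjump t) mphi phi0.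
have E : smear (pois t1) (pois_jump y t1) (smear (pois t2) (pois_jump y t2) phi)
    = smear (pois (t1 + t2)) (pois_jump y (t1 + t2)) phi.
  by apply/funext => z; exact: pois_conv.
have -> : smear (pois t1) (pois_jump y t1)
    (smear (gauss v2) id (smear (pois t2) (pois_jump y t2) phi)) =
    smear (gauss v2) id (smear (pois (t1 + t2)) (pois_jump y (t1 + t2)) phi).
  apply/funext => x.
  apply: etrans (smearC _ _ _ (mjump t1) mid (mp t2) (p0 t2)) _.
  exact: (congr1 (fun p => smear (gauss v2) id p x) E).
exact: (gauss_conv u v10 v20 (mp _) (p0 _)).
Qed.

Lemma smear_gauss_poisC d (T : measurableType d) (mu : probability T R)
    (g : T -> R) v t phi u : measurable_fun setT g ->
  measurable_fun [set: R] phi -> (forall x, 0 <= phi x) ->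
  smear mu g (gauss_pois v t phi) u = gauss_pois v t (smear mu g phi) u.
Proof.
move=> mg mphi phi0; rewrite /gauss_pois.
rewrite (smearC _ _ _ mg mid (measurable_smear _ (mjump t) mphi phi0)
  (fun x => smear_ge0 _ _ _ phi0)).
congr (smear _ _ _ _); apply/funext => x.
exact: (smearC _ _ _ mg (mjump t) mphi phi0).
Qed.

Lemma le_gauss_poisDc v t phi psi (c : R) u : (0 <= c)%R ->
  measurable_fun [set: R] phi -> (forall x, 0 <= phi x) ->
  measurable_fun [set: R] psi -> (forall x, 0 <= psi x) ->
  (forall x, phi x <= psi x + c%:E) ->
  gauss_pois v t phi u <= gauss_pois v t psi u + c%:E.
Proof.
move=> c0 mphi phi0 mpsi psi0 le_phi.
have c0E : 0 <= c%:E by rewrite lee_fin.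
have mpsic : measurable_fun [set: R] (fun x => psi x + c%:E).
  by apply: emeasurable_funD => //; exact: measurable_cst.
have psic0 x : 0 <= psi x + c%:E by rewrite adde_ge0.
have ms := measurable_smear (pois t) (mjump t) mphi phi0.
have ms' := measurable_smear (pois t) (mjump t) mpsi psi0.
have ms0 x : 0 <= smear (pois t) (pois_jump y t) phi x by exact: smear_ge0.
have ms0' x : 0 <= smear (pois t) (pois_jump y t) psi x by exact: smear_ge0.
rewrite /gauss_pois -(smearDc _ mid u ms' ms0' c0).
apply: (le_smear _ mid u ms _ ms0).
  by apply: emeasurable_funD => //; exact: measurable_cst.
move=> x; rewrite -(smearDc _ (mjump t) x mpsi psi0 c0).
exact: (le_smear _ (mjump t) x mphi mpsic phi0 le_phi).
Qed.

End gauss_pois_operator.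

Section lindeberg.
Local Open Scope ereal_scope.
Context d (T : measurableType d) (R : realType) (P : probability T R).
Context n (X : 'I_n -> {RV P >-> R}) (X_indep : mutually_independent P X).

Lemma integral_partial_sum_cons i s (phi : R -> \bar R) : uniq (i :: s) ->
  measurable_fun [set: R] phi -> (forall x, 0 <= phi x) ->
  \int[P]_w phi (partial_sum X (i :: s) w) =
  \int[P]_w smear P (X i) phi (partial_sum X s w).
Proof.
move=> us mphi phi0; rewrite /smear.
have mF : measurable_fun setT (fun z : R * R => phi (z.1 + z.2)%R).
  by apply: (measurableT_comp mphi); exact: measurable_funD.
rewrite -(independent_pair_integral (independent_partial_sum X_indep us) mF)//.
by apply: eq_integral => w _; rewrite !partial_sumE big_cons addrC.
Qed.

Context (y : R) (phi : R -> \bar R) (mphi : measurable_fun [set: R] phi)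
  (phi0 : forall x, 0 <= phi x) (v t c : 'I_n -> R)
  (v0 : forall i, (0 <= v i)%R) (t0 : forall i, (0 <= t i)%R)
  (c0 : forall i, (0 <= c i)%R)
  (X_le : forall i u,
    smear P (X i) phi u <= gauss_pois y (v i) (t i) phi u + (c i)%:E).

(** Induction over the summands: conditioning on X i exposes the operator of X i,
    which commutes with the accumulated operator, so that the one-variable
    inequality for phi itself can be used. No property of phi beyond that
    inequality has to be preserved by convolution. *)
Lemma lindeberg s v' t' : uniq s -> (0 <= v')%R -> (0 <= t')%R ->
  \int[P]_w gauss_pois y v' t' phi (partial_sum X s w) <=
  gauss_pois y (v' + \sum_(i <- s) v i) (t' + \sum_(i <- s) t i) phi 0
  + (\sum_(i <- s) c i)%:E.
Proof.
elim: s v' t' => [|i s IH] v' t'.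
  move=> _ _ _; rewrite !big_nil !addr0.
  have -> : \int[P]_w gauss_pois y v' t' phi (partial_sum X [::] w) =
      \int[P]_w (cst (gauss_pois y v' t' phi 0) w).
    by apply: eq_integral => w _; rewrite partial_sumE big_nil.
  by rewrite integral_cst// [X in _ * X]probability_setT mule1.
move=> us v'0 t'0; have /= /andP[_ us'] := us.
have gm v1 t1 := measurable_gauss_pois y v1 t1 mphi phi0.
have g0 v1 t1 x : 0 <= gauss_pois y v1 t1 phi x by exact: gauss_pois_ge0.
have mS : measurable_fun setT (partial_sum X s) by exact: measurable_funP.
rewrite (integral_partial_sum_cons us (gm _ _) (g0 _ _)).
rewrite !big_cons addrA [(t' + (_ + _))%R]addrA.
apply: (@le_trans _ _ (\int[P]_w
    (gauss_pois y (v' + v i) (t' + t i) phi (partial_sum X s w) + (c i)%:E))).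
  apply: ge0_le_integral => //.
  - by move=> w _; exact: smear_ge0.
  - apply: (measurableT_comp _ mS).
    exact: (measurable_smear P _ (gm v' t') (g0 v' t')).
  - apply: emeasurable_funD; last exact: measurable_cst.
    exact: (measurableT_comp (gm _ _) mS).
  - move=> w _; rewrite smear_gauss_poisC// -gauss_poisD//.
    apply: le_gauss_poisDc => //.
    exact: measurable_smear.
    by move=> x; exact: smear_ge0.
rewrite ge0_integralD//; last 2 first.
- exact: (measurableT_comp (gm _ _) mS).
- by move=> w _; rewrite lee_fin.
rewrite integral_cst// [X in _ * X]probability_setT mule1.
rewrite EFinD [((c i)%:E + _)]addeC addeA leeD2r//.
exact: IH us' (addr_ge0 v'0 (v0 i)) (addr_ge0 t'0 (t0 i)).
Qed.

End lindeberg.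

(** * Law of the comparison variable *)

Section integral_facts.
Local Open Scope ereal_scope.
Context {R : realType}.

(** When the integral of F is infinite, [integralD] does not apply; the four
    positive and negative parts are compared instead. *)
Lemma ge0_integralD_integrable d (T : measurableType d)
    (mu : {measure set T -> \bar R}) (F L : T -> R) :
  measurable_fun setT F -> (forall x, (0 <= F x)%R) ->
  mu.-integrable setT (EFin \o L) ->
  \int[mu]_x (F x + L x)%:E = \int[mu]_x (F x)%:E + \int[mu]_x (L x)%:E.
Proof.
move=> mF F0 iL.
pose H x := (F x + L x)%R.
have mFE : measurable_fun setT (EFin \o F) by exact: measurableT_comp.
have mL := measurable_int _ iL.
have mH : measurable_fun setT (EFin \o H).
  apply: (@eq_measurable_fun _ _ _ _ _ (fun x => (F x)%:E + (L x)%:E)) => //.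
  exact: emeasurable_funD.
have Hneg x : (EFin \o H)^\- x <= (EFin \o L)^\- x.
  rewrite !funenegE /= ge_max; apply/andP; split.
    by rewrite le_max; apply/orP; left; rewrite lee_fin /H lerN2 lerDr.
  by rewrite le_max lexx orbT.
have partE : \int[mu]_x (EFin \o H)^\+ x + \int[mu]_x (EFin \o L)^\- x =
    \int[mu]_x (F x)%:E + \int[mu]_x (EFin \o L)^\+ x + \int[mu]_x (EFin \o H)^\- x.
  have mLp := measurable_funepos mL; have mLn := measurable_funeneg mL.
  have mHp := measurable_funepos mH; have mHn := measurable_funeneg mH.
  have F0E x : 0 <= (F x)%:E by rewrite lee_fin.
  rewrite -!ge0_integralD//.
  all: try exact: emeasurable_funD.
  all: try (by move=> x _; exact: adde_ge0).
  apply: eq_integral => x _; rewrite !funeposE !funenegE /= -!EFin_max -!EFinD.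
  congr EFin; rewrite /H.
  by case: (leP (F x + L x) 0)%R; case: (leP (L x) 0)%R;
    case: (leP (- (F x + L x)) 0)%R; case: (leP (- L x) 0)%R; lra.
have p_fin := integrable_pos_fin_num measurableT iL.
have q_fin := integrable_neg_fin_num measurableT iL.
have r_fin : \int[mu]_x (EFin \o H)^\- x \is a fin_num.
  rewrite ge0_fin_numE; last by apply: integral_ge0.
  apply: (le_lt_trans (ge0_le_integral _ measurableT _ _ _ (fun x _ => Hneg x))).
  - by [].
  - exact: measurable_funeneg.
  - exact: measurable_funeneg.
  - by rewrite -ge0_fin_numE//; exact: integral_ge0.
have F_ge0 : 0 <= \int[mu]_x (F x)%:E by apply: integral_ge0 => x _; rewrite lee_fin.
have s_ge0 : 0 <= \int[mu]_x (EFin \o H)^\+ x by exact: integral_ge0.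
rewrite [LHS]integralE [X in _ = _ + X]integralE.
move: partE p_fin q_fin r_fin F_ge0 s_ge0.
move: (\int[mu]_x (EFin \o H)^\+ x) (\int[mu]_x (EFin \o L)^\- x)
  (\int[mu]_x (F x)%:E) (\int[mu]_x (EFin \o L)^\+ x) (\int[mu]_x (EFin \o H)^\- x).
move=> [s| |] [q| |] [a| |] [p| |] [r| |] //= [] E _ _ _ _ _.
by rewrite -!EFinB -EFinD; congr EFin; lra.
Qed.

End integral_facts.

Section target_law.
Local Open Scope ereal_scope.
Context {R : realType} d (T : measurableType d) (P : probability T R).
Context (G : {RV P >-> R}) (N : {RV P >-> nat}) (v t y : R).
Context (v_gt0 : (0 < v)%R) (t_gt0 : (0 < t)%R).
Context (G_normal : centered_normal P v G) (N_poisson : poisson P t N)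
  (GN_indep : independent_pair P G N).

Lemma integral_centered_normal (phi : R -> \bar R) :
  measurable_fun [set: R] phi -> (forall x, 0 <= phi x) ->
  \int[P]_w phi (G w) = \int[gauss v]_x phi x.
Proof.
move=> mphi phi0.
have := ge0_integral_distribution G mphi phi0 => /= <-.
(* the two measures live on two copies of the line, identified by id *)
transitivity (\int[pushforward (gauss v) (id : measurableTypeR R -> R)]_x phi x).
  apply: eq_measure_integral => A mA _.
  rewrite [LHS](G_normal mA) /pushforward /gauss gt_eqF//.
have mid : measurable_fun [set: measurableTypeR R] (id : _ -> R).
  exact: measurable_id.
by rewrite ge0_integral_pushforward.
Qed.

Lemma integral_poisson (g : nat -> \bar R) : (forall k, 0 <= g k) ->
  \int[P]_w g (N w) = \int[pois t]_k g k.
Proof.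
move=> g0; have mg : measurable_fun setT g by [].
have := ge0_integral_distribution N mg g0 => /= <-.
by apply: eq_measure_integral => A mA _; exact: N_poisson.
Qed.

Lemma integral_gauss_pois (phi : R -> \bar R) :
  measurable_fun [set: R] phi -> (forall x, 0 <= phi x) ->
  \int[P]_w phi (G w + pois_jump y t (N w))%R = gauss_pois y v t phi 0.
Proof.
move=> mphi phi0.
have mF : measurable_fun setT (fun z : R * nat => phi (z.1 + pois_jump y t z.2)%R).
  apply: (measurableT_comp mphi); apply: measurable_funD => //.
  exact: (measurableT_comp (measurable_pois_jump y t)).
have := independent_pair_integral GN_indep mF (fun=> phi0 _) => /= ->.
have mp := measurable_smear (pois t) (measurable_pois_jump y t) mphi phi0.
transitivity (\int[P]_w smear (pois t) (pois_jump y t) phi (G w)).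
  apply: eq_integral => w _.
  exact: (integral_poisson (fun k => phi0 (G w + pois_jump y t k)%R)).
rewrite (integral_centered_normal mp); last first.
  by move=> x; exact: smear_ge0.
by apply: eq_integral => x _; rewrite add0r.
Qed.

Lemma centered_normal_integrable : P.-integrable setT (EFin \o G).
Proof.
apply/integrableP; split; first exact: measurableT_comp.
have mabs : measurable_fun [set: R] (fun x : R => `|x|%:E).
  by apply: measurableT_comp => //; exact: measurableT_comp.
have := integral_centered_normal mabs (fun x => _).
move=> /= -> //.
exact: gauss_abs_moment (ltW v_gt0).
Qed.

(** The symmetry of the law exchanges the positive and the negative parts. *)
Lemma centered_normal_mean : \int[P]_w (G w)%:E = 0.
Proof.
have mp : measurable_fun [set: R] (fun x : R => (Num.max x 0)%:E).
  by apply: measurableT_comp => //; exact: measurable_maxr.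
have mn : measurable_fun [set: R] (fun x : R => (Num.max (- x) 0)%:E).
  apply: measurableT_comp => //; apply: measurable_maxr => //.
have p0 (x : R) : 0 <= (Num.max x 0)%:E by rewrite lee_fin le_max lexx orbT.
have n0 (x : R) : 0 <= (Num.max (- x) 0)%:E by rewrite lee_fin le_max lexx orbT.
have pE : \int[P]_w (EFin \o G)^\+ w = \int[P]_w (Num.max (G w) 0)%:E.
  by apply: eq_integral => w _; rewrite funeposE /= EFin_max.
have nE : \int[P]_w (EFin \o G)^\- w = \int[P]_w (Num.max (- G w) 0)%:E.
  by apply: eq_integral => w _; rewrite funenegE /= EFin_max.
have np : \int[P]_w (EFin \o G)^\- w = \int[P]_w (EFin \o G)^\+ w.
  rewrite pE nE (integral_centered_normal mp p0).
  rewrite (integral_centered_normal mn n0).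
  have := gauss_symm 0 (ltW v_gt0) mp p0; rewrite /smear.
  under eq_integral do rewrite add0r.
  by under [in X in _ = X -> _]eq_integral do rewrite add0r.
rewrite [LHS]integralE np subee//.
exact (integrable_pos_fin_num measurableT centered_normal_integrable).
Qed.

Lemma poisson_mean : \int[P]_w ((N w)%:R : R)%:E = t%:E.
Proof.
rewrite (integral_poisson (g := fun k => (k%:R)%:E))//.
have := @pois_ffact_moment R t 1 (ltW t_gt0).
rewrite expr1 => <-; apply: eq_integral => k _.
by rewrite ffactn1.
Qed.

Lemma poisson_integrable : P.-integrable setT (fun w => ((N w)%:R : R)%:E).
Proof.
have mN : measurable_fun setT (fun w => ((N w)%:R : R)%:E).
  have mg : measurable_fun [set: nat] (fun k => (k%:R : R)%:E) by [].
  exact: (measurableT_comp mg).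
apply/integrableP; split => //.
under eq_integral do rewrite gee0_abs ?lee_fin//.
by rewrite poisson_mean ltry.
Qed.

Lemma integral_affine_gauss_pois (a b : R) :
  P.-integrable setT (EFin \o (fun w => a + b * (G w + pois_jump y t (N w)))%R) /\
  \int[P]_w (a + b * (G w + pois_jump y t (N w)))%:E = a%:E.
Proof.
have iG := integrableZl measurableT b centered_normal_integrable.
have iN := integrableZl measurableT (b * y) poisson_integrable.
have ic : P.-integrable setT (fun=> (a - b * y * t)%:E).
  exact: finite_measure_integrable_cst.
have icG := integrableD measurableT ic iG.
have E w : (a + b * (G w + pois_jump y t (N w)))%:E =
    (a - b * y * t)%:E + b%:E * (EFin \o G) w + (b * y)%:E * ((N w)%:R : R)%:E.
  by rewrite /= -!EFinM -!EFinD /pois_jump; congr EFin; ring.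
split.
  apply: (@eq_integrable _ _ _ _ _ measurableT _ _ _ (integrableD measurableT icG iN)).
  by move=> w _; rewrite [RHS]E.
under eq_integral do rewrite E.
rewrite (integralD measurableT icG iN) (integralD measurableT ic iG).
rewrite (integralZl measurableT centered_normal_integrable).
rewrite (integralZl measurableT poisson_integrable).
rewrite centered_normal_mean poisson_mean.
rewrite integral_cst// [X in _ * X]probability_setT mule1 mule0 adde0.
by rewrite -EFinM -EFinD; congr EFin; ring.
Qed.

End target_law.

(** * Moments of the summands and conclusion *)

Lemma fine_sum_bounded (R : realType) n (e : 'I_n -> \bar R) (b : R) :
  (forall i, (0 <= e i)%E) -> (\sum_(i < n) e i <= b%:E)%E ->
  (forall i, e i = (fine (e i))%:E) /\ \sum_(i < n) fine (e i) <= b.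
Proof.
move=> e0 eb; have efin i : e i = (fine (e i))%:E.
  rewrite fineK// ge0_fin_numE//; apply: le_lt_trans (ltry b).
  apply: le_trans eb; rewrite (bigD1 i)//= leeDl//.
  by apply: sume_ge0 => j _.
split=> //; rewrite -lee_fin -sumEFin; apply: le_trans eb.
by apply: lee_sum => i _; rewrite -efin.
Qed.

Lemma integrable_of_second_moment d (T : measurableType d) (R : realType)
    (P : probability T R) (X : {RV P >-> R}) (s : R) :
  (\int[P]_w (X w ^+ 2)%:E = s%:E)%E -> P.-integrable setT (EFin \o X).
Proof.
move=> X2; have iX2 : P.-integrable setT (fun w => (X w ^+ 2)%:E).
  apply/integrableP; split.
    by apply: measurableT_comp => //; exact: measurable_funX.
  under eq_integral do rewrite gee0_abs ?lee_fin ?sqr_ge0//.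
  by rewrite X2 ltry.
have i1 : P.-integrable setT (fun=> 1%:E) by exact: finite_measure_integrable_cst.
apply: (le_integrable measurableT _ _ (integrableD measurableT i1 iX2)).
  exact: measurableT_comp.
move=> w _ /=; rewrite lee_fin.
rewrite [leRHS]ger0_norm ?addr_ge0 ?sqr_ge0//.
rewrite -[X in _ <= 1 + X]real_normK ?num_real//.
by have := sqr_ge0 (`|X w| - 1)%R; nra.
Qed.

Lemma pos_cube_moment_le d (T : measurableType d) (R : realType)
    (P : probability T R) (X : {RV P >-> R}) (y s b : R) : 0 < y ->
  {ae P, forall w, X w <= y} ->
  (\int[P]_w (X w ^+ 2)%:E = s%:E)%E ->
  (\int[P]_w (Num.max 0 (X w) ^+ 3)%:E = b%:E)%E -> b <= y * s.
Proof.
move=> y0 Xy X2 X3; rewrite -lee_fin -X3 EFinM -X2.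
have mX2 : measurable_fun setT (fun w => (X w ^+ 2)%:E).
  by apply: measurableT_comp => //; exact: measurable_funX.
have X20 w : (0 <= (X w ^+ 2)%:E)%E by rewrite lee_fin sqr_ge0.
rewrite -(ge0_integralZl_EFin _ measurableT (fun w _ => X20 w) mX2 (ltW y0)).
apply: ae_ge0_le_integral => //.
- by move=> w _; rewrite lee_fin exprn_ge0// le_max lexx.
- apply: measurableT_comp => //; apply: measurable_funX.
  exact: measurable_maxr.
- by move=> w _; rewrite mule_ge0// lee_fin ltW.
- exact: measurable_funeM.
- apply: filterS Xy => w Xwy _; rewrite -EFinM lee_fin.
  have [X0|X0] := leP 0 (X w); last by rewrite expr0n /= mulr_ge0 ?sqr_ge0 ?ltW.
  by rewrite exprS ler_wpM2r ?sqr_ge0.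
Qed.

Unset Implicit Arguments.

Theorem theorem2p1 (R : realType) (sigma y beta eps : R)
  (sigma_gt0 : 0 < sigma) (y_gt0 : 0 < y) (beta_gt0 : 0 < beta)
  (epsE : eps = beta / (sigma ^+ 2 * y)) (eps_gt0 : 0 < eps) (eps_lt1 : eps < 1)
  (d : measure_display) (T : measurableType d) (P : probability T R)
  (n : nat) (X : 'I_n -> {RV P >-> R})
  (X_indep : mutually_independent P X)
  (X_var : (\sum_(i < n) 'E_P[fun w => (X i w ^+ 2)%R] <= (sigma ^+ 2)%:E)%E)
  (X_pos3 : (\sum_(i < n) 'E_P[fun w => (Num.max 0 (X i w) ^+ 3)%R] <= beta%:E)%E)
  (X_mean : forall i, ('E_P[X i] <= 0)%E)
  (X_le : forall i, {ae P, forall w, X i w <= y})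
  (d' : measure_display) (T' : measurableType d') (P' : probability T' R)
  (G : {RV P' >-> R}) (N : {RV P' >-> nat})
  (G_normal : centered_normal P' ((1 - eps) * sigma ^+ 2) G)
  (N_poisson : poisson P' (eps * sigma ^+ 2 / y ^+ 2) N)
  (GN_indep : independent_pair P' G N)
  (f : R -> R) (f_F : Fplus3 f) :
  ('E_P[fun w => f (\sum_(i < n) X i w)%R] <=
   'E_P'[fun w => f (G w + y * ((N w)%:R - eps * sigma ^+ 2 / y ^+ 2))%R])%E.
Proof.
have s2_gt0 : 0 < sigma ^+ 2 by rewrite exprn_gt0.
have y3_gt0 : 0 < y ^+ 3 by rewrite exprn_gt0.
have y2_gt0 : 0 < y ^+ 2 by rewrite exprn_gt0.
set v' := (1 - eps) * sigma ^+ 2 in G_normal *.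
set t' := eps * sigma ^+ 2 / y ^+ 2 in N_poisson *.
have v'_gt0 : 0 < v' by rewrite mulr_gt0// subr_gt0.
have t'_gt0 : 0 < t' by rewrite divr_gt0// mulr_gt0.
have beta_lt : beta < sigma ^+ 2 * y.
  by move: eps_lt1; rewrite epsE ltr_pdivrMr ?mul1r// mulr_gt0.
have epsE' : eps * sigma ^+ 2 = beta / y.
  by rewrite epsE; field; rewrite !gt_eqF.
have [df df1] := Fplus3_der f_F.
have [_ f_homo f_conv f2_homo f2_conv] := f_F.
have f_convP := convex_functionP f_conv.
have f2_convP := convex_functionP f2_conv.
set f1 := (f^`())%classic in df df1 *.
set f2 := (f^`(2))%classic in df1 f2_homo f2_convP f2_conv *.
have f2_ge0 := ge0_second_der df df1 f2_homo f_convP.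
have f1_ge0 := ge0_first_der df df1 f2_ge0 f_homo.
(* subtracting the tangent at 0 makes the function nonnegative *)
pose c := f1 0; pose h x := f x - f 0 - c * x; pose h1 x := f1 x - c.
have dh x : has_der h x (h1 x).
  by rewrite /h /h1; der_ring.
have dh1 x : has_der h1 x (f2 x).
  by rewrite /h1; der_ring.
have h_ge0 x : 0 <= h x.
  by have := ge_tangent df df1 f2_ge0 0 x; rewrite add0r /h /c; lra.
have h1_ge x : - c <= h1 x by have := f1_ge0 x; rewrite /h1; lra.
have mh := has_der_measurable dh.
have mhE : measurable_fun [set: R] (EFin \o h) by exact: measurableT_comp.
have hE0 x : (0 <= (EFin \o h) x)%E by rewrite lee_fin.
rewrite expectation.unlock in X_var X_pos3 X_mean *.
have X2_ge0 i : (0 <= \int[P]_w (X i w ^+ 2)%:E)%E.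
  by apply: integral_ge0 => w _; rewrite lee_fin sqr_ge0.
have X3_ge0 i : (0 <= \int[P]_w (Num.max 0 (X i w) ^+ 3)%:E)%E.
  by apply: integral_ge0 => w _; rewrite lee_fin exprn_ge0// le_max lexx.
have [s2E s2_sum] := fine_sum_bounded X2_ge0 X_var.
have [b3E b3_sum] := fine_sum_bounded X3_ge0 X_pos3.
pose s2 i := fine (\int[P]_w (X i w ^+ 2)%:E).
pose b3 i := fine (\int[P]_w (Num.max 0 (X i w) ^+ 3)%:E).
rewrite -/(\sum_(i < n) s2 i) in s2_sum.
rewrite -/(\sum_(i < n) b3 i) in b3_sum.
have iX i := integrable_of_second_moment (s2E i).
pose m i := fine (\int[P]_w (X i w)%:E).
have mE i : (\int[P]_w (X i w)%:E = (m i)%:E)%E.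
  by rewrite fineK// (integrable_fin_num measurableT (iX i)).
have m_le0 i : m i <= 0 by rewrite -lee_fin -mE; exact: X_mean.
have b3_le i : b3 i <= y * s2 i.
  exact: pos_cube_moment_le y_gt0 (X_le i) (s2E i) (b3E i).
have b3_ge0 i : 0 <= b3 i.
  exact: fine_ge0 (X3_ge0 i).
set q := sigma ^+ 2 in s2_sum s2_gt0 beta_lt v' t' epsE' v'_gt0 t'_gt0 G_normal N_poisson *.
set S2 := \sum_(i < n) s2 i in s2_sum; set B := \sum_(i < n) b3 i in b3_sum.
have den_gt0 : 0 < y * q - B.
  by rewrite subr_gt0 (le_lt_trans b3_sum)// mulrC.
(* tau interpolates between the third moments b3 i and their largest possible
   values y * s2 i so as to exhaust beta; the unused variance q - S2 is treated
   as that of one more summand, with third moment 0, which yields v0 and t0 *)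
pose tau := (beta - B) / (y * q - B).
have tau_ge0 : 0 <= tau by apply: divr_ge0; [rewrite subr_ge0|exact: ltW].
have tau_le1 : tau <= 1.
  by rewrite ler_pdivrMr// mul1r lerD2r mulrC ltW.
have tauE : tau * (y * q - B) = beta - B by rewrite /tau divfK// gt_eqF.
pose b i := b3 i + tau * (y * s2 i - b3 i).
have b3_le_b i : b3 i <= b i by rewrite lerDl mulr_ge0// subr_ge0.
have b_le i : b i <= y * s2 i by have := b3_le i; rewrite /b; nra.
have b_ge0 i : 0 <= b i by exact: le_trans (b3_ge0 i) (b3_le_b i).
pose v i := s2 i - b i / y; pose t i := b i / y ^+ 3.
have v_ge0 i : 0 <= v i by rewrite subr_ge0 ler_pdivrMr// mulrC.
have t_ge0 i : 0 <= t i by rewrite divr_ge0// ltW.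
pose v0 := (1 - tau) * (q - S2); pose t0 := tau * (q - S2) / y ^+ 2.
have v0_ge0 : 0 <= v0 by rewrite mulr_ge0// subr_ge0.
have t0_ge0 : 0 <= t0.
  by apply: divr_ge0; [rewrite mulr_ge0// subr_ge0|exact: ltW].
have b_sum : \sum_(i < n) b i = B + tau * (y * S2 - B).
  by rewrite big_split/= -mulr_sumr sumrB -mulr_sumr.
have v_sum : v0 + \sum_(i < n) v i = v'.
  have -> : v' = q - beta / y by rewrite /v' mulrBl mul1r epsE'.
  rewrite sumrB -mulr_suml b_sum -/S2 /v0.
  have -> : beta = tau * (y * q - B) + B by rewrite tauE subrK.
  by field; rewrite gt_eqF.
have t_sum : t0 + \sum_(i < n) t i = t'.
  rewrite -mulr_suml b_sum /t0 /t' epsE'.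
  have -> : beta = tau * (y * q - B) + B by rewrite tauE subrK.
  by field; rewrite gt_eqF.
have c_ge0 : 0 <= c by exact: f1_ge0.
have cm_ge0 i : 0 <= c * - m i by rewrite mulr_ge0// oppr_ge0.
have step i u : (smear P (X i) (EFin \o h) u <=
    gauss_pois y (v i) (t i) (EFin \o h) u + (c * - m i)%:E)%E.
  exact: (smear_le_gauss_pois dh dh1 f2_ge0 f2_homo f2_convP h_ge0
    (@measurable_funPT _ _ _ _ (X i)) y_gt0 (iX i) (mE i) (s2E i) (b3E i)
    (X_le i) u h1_ge (m_le0 i) (b3_le_b i) (b_ge0 i) (b_le i)).
have := lindeberg X_indep mhE hE0 v_ge0 t_ge0 cm_ge0 step
  (index_enum_uniq 'I_n) v0_ge0 t0_ge0.
rewrite v_sum t_sum => lind.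
pose S := partial_sum X (index_enum 'I_n).
have mS : measurable_fun setT S by exact: measurable_funPT.
have hS : (\int[P]_w (h (S w))%:E <=
    gauss_pois y v' t' (EFin \o h) 0 + (\sum_(i < n) c * - m i)%:E)%E.
  apply: le_trans lind; apply: ge0_le_integral => //.
  - by move=> w _; exact: hE0.
  - exact: (measurableT_comp mhE mS).
  - exact: (measurableT_comp (measurable_gauss_pois y v0 t0 mhE hE0) mS).
  - move=> w _.
    apply: le_trans (le_gauss_pois_smear dh dh1 f2_ge0 f2_convP h_ge0 (S w)
      v0_ge0 t0_ge0 (ltW y_gt0)).
    rewrite lee_fin -addrA lerDl addr_ge0// mulr_ge0//.
      by rewrite divr_ge0.
    exact: (jump_ge0 dh dh1 f2_ge0).
have icX i := integrableZl measurableT c (iX i).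
have if0 : P.-integrable setT (fun=> (f 0)%:E).
  exact: finite_measure_integrable_cst.
have isum := integrable_sum measurableT (index_enum 'I_n) (fun i (_ : true) => icX i).
have affE w : (f 0 + c * S w)%:E =
    ((f 0)%:E + \sum_(i < n) c%:E * (EFin \o X i) w)%E.
  rewrite /S partial_sumE mulr_sumr EFinD -sumEFin; congr (_ + _)%E.
have iL : P.-integrable setT (EFin \o (fun w => f 0 + c * S w)).
  apply: (@eq_integrable _ _ _ _ _ measurableT _ _ _ (integrableD measurableT if0 isum)).
  by move=> w _; rewrite [RHS]affE.
have LE : (\int[P]_w (f 0 + c * S w)%:E = (f 0 + c * \sum_(i < n) m i)%:E)%E.
  under eq_integral do rewrite affE.
  rewrite (integralD measurableT if0 isum) integral_cst// [X in (_ * X)%E]probability_setT.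
  rewrite mule1 (integral_sum measurableT icX) EFinD; congr (_ + _)%E.
  rewrite mulr_sumr -sumEFin; apply: eq_bigr => i _.
  by rewrite (integralZl measurableT (iX i)) mE.
have lhsE : (\int[P]_w (f (\sum_(i < n) X i w))%:E =
    \int[P]_w (h (S w))%:E + (f 0 + c * \sum_(i < n) m i)%:E)%E.
  rewrite -LE -ge0_integralD_integrable//; last exact: (measurableT_comp mh mS).
  apply: eq_integral => w _; congr EFin.
  by rewrite /S partial_sumE /h; ring.
pose W w := G w + pois_jump y t' (N w).
have [iW WE] := integral_affine_gauss_pois y v'_gt0 t'_gt0 G_normal N_poisson (f 0) c.
have rhsE : (\int[P']_w (f (G w + y * ((N w)%:R - t')))%:E =
    gauss_pois y v' t' (EFin \o h) 0 + (f 0)%:E)%E.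
  rewrite -WE -(integral_gauss_pois y v'_gt0 G_normal N_poisson GN_indep mhE hE0).
  rewrite -ge0_integralD_integrable//.
    by apply: eq_integral => w _; congr EFin; rewrite /h /pois_jump; ring.
  apply: (measurableT_comp mh); apply: measurable_funD => //.
  exact: (measurableT_comp (measurable_pois_jump y t')).
rewrite lhsE rhsE.
apply: le_trans (leeD2r _ hS) _.
rewrite -addeA -EFinD leeD2l// lee_fin mulr_sumr addrCA -big_split/= big1 ?addr0//.
by move=> i _; ring.
Qed.
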